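(* Let $(X,d)$ be a length space. If $n\ge 5$ and $(X,d)$ satisfies a $C$-rough $n$-point condition for some $C\ge 0$, then $(X,d)$ is $C'$-rCAT$(0)$, where $C'=C+2\sqrt{3}$. Conversely, if $(X,d)$ is $C_0$-rCAT$(0)$ for some $C_0>0$, then for all $n\ge 3$, $(X,d)$ satisfies a $C$-rough $n$-point condition, where $C=(n-2)C_0$.
   Context: $\mathbb{R}^2$ carries the Euclidean metric $|\cdot-\cdot|$; $n$ is always an integer. Short segments. Let $(X,d)$ be a metric space and $h\ge 0$. An $h$-short segment in $X$ is a path $\gamma:[0,L]\to X$, $L\ge 0$, with $\mathrm{len}(\gamma)\ge d(\gamma(0),\gamma(L))\ge \mathrm{len}(\gamma)-h$, where $\mathrm{len}$ is path length. $[x,y]_h$ denotes an $h$-short segment from $x$ to $y$ (and also its image). For a point $z=\gamma(t)$ of such a path, $[x,z]_h$ and $[z,y]_h$ denote the subpaths $\gamma|_{[0,t]}$ and $\gamma|_{[t,L]}$. $(X,d)$ is a length space if for every $x,y\in X$ and every $h>0$ there is an $h$-short segment $[x,y]_h$. Triangles. An $h$-short triangle $T_h(x_1,x_2,x_3)$ with vertices $x_1,x_2,x_3\in X$ is a collection of $h$-short segments $[x_1,x_2]_h,[x_2,x_3]_h,[x_3,x_1]_h$ (its sides). A comparison triangle is a Euclidean triangle $T(\bar x_1,\bar x_2,\bar x_3)$ in $\mathbb{R}^2$ with $|\bar x_i-\bar x_j|=d(x_i,x_j)$ for $i,j\in\{1,2,3\}$. A point $\bar u\in[\bar x_i,\bar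 x_j]$ is a comparison point for $u\in[x_i,x_j]_h$ if $|\bar x_i-\bar u|\le \mathrm{len}([x_i,u]_h)$ and $|\bar u-\bar x_j|\le \mathrm{len}([u,x_j]_h)$. Rough CAT(0). Given $C>0$ and $H:X\times X\times X\to(0,\infty)$, a length space $(X,d)$ is $C$-rCAT$(0;H)$ if $d(u,v)\le|\bar u-\bar v|+C$ whenever $x,y,z\in X$, $T=T_h(x,y,z)$ is an $h$-short triangle with $h=H(x,y,z)$, $\bar T=T(\bar x,\bar y,\bar z)$ is a comparison triangle in $\mathbb{R}^2$ for $T$, $u,v$ lie on different sides of $T$, and $\bar u,\bar v\in\bar T$ are comparison points for $u,v$ respectively. $(X,d)$ is $C$-rCAT$(0)$ if it is $C$-rCAT$(0;H)$ with $H(x,y,z)=1/\max\{1,d(x,y),d(x,z),d(y,z)\}$. Rough $n$-point condition. Let $C\ge 0$, $n\ge 3$. Let $x_i\in X$ and $\overline{x}_i\in\mathbb{R}^2$ for $0\le i\le n$, with $x_0=x_n$ and $\overline{x}_0=\overline{x}_n$. Then $(\overline{x}_1,\dots,\overline{x}_n)$ is a $C$-rough subembedding of $(x_1,\dots,x_n)$ into $\mathbb{R}^2$ if $d(x_i,x_{i-1})=|\overline{x}_i-\overline{x}_{i-1}|$ for $1\le i\le n$; $d(x_1,x_i)\le|\overline{x}_1-\overline{x}_i|$ for $2\le i\le n$; and $d(x_i,x_j)\le|\overline{x}_i-\overline{x}_j|+C$ for $2\le i,j\le n$. $(X,d)$ satisfies the $C$-rough $n$-point condition if every $n$-tuple in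 $X$ has a $C$-rough subembedding into $\mathbb{R}^2$. *)

(* Defs.v *)
From HB Require Import structures.
From mathcomp Require Import all_boot all_order all_algebra.
From mathcomp Require Import all_classical all_reals all_analysis.

Set Implicit Arguments.
Unset Strict Implicit.
Unset Printing Implicit Defensive.

Import Order.TTheory GRing.Theory Num.Theory.
Import numFieldNormedType.Exports.

Local Open Scope classical_set_scope.
Local Open Scope ring_scope.

(* The library norm on 'rV[R]_2 is the sup norm, not the Euclidean one. *)
Definition eucl_dist {R : realType} (p q : 'rV[R]_2) : R :=
  Num.sqrt (\sum_(k < 2) (p 0 k - q 0 k) ^+ 2).

Definition eucl_segment {R : realType} (p q : 'rV[R]_2) : set 'rV[R]_2 :=
  [set (1 - s) *: p + s *: q | s in `[0, 1]].

(* Length of the restriction of g to [a, b]; it mirrors [total_variation],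
   which the library only has for real-valued functions. *)
Definition path_length {R : realType} {X : metricType R} (a b : R) (g : R -> X)
    : \bar R :=
  ereal_sup
    [set (\sum_(0 <= i < size s)
            mdist (g (nth b (a :: s) i)) (g (nth b (a :: s) i.+1)))%:E
    | s in [set s | itv_partition a b s]].

(* The path is the restriction of g to [0, L]; values of g elsewhere are
   irrelevant. *)
Definition short_segment {R : realType} {X : metricType R} (h : R) (x y : X)
    (L : R) (g : R -> X) : Prop :=
  [/\ 0 <= L, {within `[0, L], continuous g}, g 0 = x, g L = y
    & ((mdist x y)%:E <= path_length 0 L g)%E /\
      (path_length 0 L g - h%:E <= (mdist x y)%:E)%E].

Definition length_space {R : realType} (X : metricType R) : Prop :=
  forall (x y : X) (h : R), 0 < h ->
    exists (L : R) (g : R -> X), short_segment h x y L g.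

(* Vertices are indexed cyclically; side i goes from x i to x (i + 1). *)
Definition short_triangle {R : realType} {X : metricType R} (h : R)
    (x : 'Z_3 -> X) (L : 'Z_3 -> R) (g : 'Z_3 -> R -> X) : Prop :=
  forall i, short_segment h (x i) (x (i + 1)) (L i) (g i).

Definition comparison_triangle {R : realType} {X : metricType R}
    (x : 'Z_3 -> X) (xb : 'Z_3 -> 'rV[R]_2) : Prop :=
  forall i j, eucl_dist (xb i) (xb j) = mdist (x i) (x j).

(* ub is a comparison point for the point g t of the side g : [0, L] -> X,
   pb and qb being the comparison vertices of g 0 and g L. *)
Definition comparison_point {R : realType} {X : metricType R}
    (pb qb : 'rV[R]_2) (L : R) (g : R -> X) (t : R) (ub : 'rV[R]_2) : Prop :=
  [/\ eucl_segment pb qb ub,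
      ((eucl_dist pb ub)%:E <= path_length 0 t g)%E
    & ((eucl_dist ub qb)%:E <= path_length t L g)%E].

Definition rCAT0_for {R : realType} (X : metricType R) (C : R)
    (H : X -> X -> X -> R) : Prop :=
  [/\ 0 < C, forall x y z, 0 < H x y z, length_space X
    & forall (x : 'Z_3 -> X) (L : 'Z_3 -> R) (g : 'Z_3 -> R -> X)
             (xb : 'Z_3 -> 'rV[R]_2),
        short_triangle (H (x 0) (x 1) (x 2)) x L g ->
        comparison_triangle x xb ->
        forall (i j : 'Z_3) (t s : R) (ub vb : 'rV[R]_2),
          i != j -> 0 <= t <= L i -> 0 <= s <= L j ->
          comparison_point (xb i) (xb (i + 1)) (L i) (g i) t ub ->
          comparison_point (xb j) (xb (j + 1)) (L j) (g j) s vb ->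
          mdist (g i t) (g j s) <= eucl_dist ub vb + C].

Definition rCAT0 {R : realType} (X : metricType R) (C : R) : Prop :=
  rCAT0_for C (fun x y z : X =>
    1 / Num.max 1 (Num.max (mdist x y) (Num.max (mdist x z) (mdist y z)))).

(* The points x_1, ..., x_n are x 0, ..., x (n - 1) here, and [ordS] is the
   cyclic successor, which encodes the convention x_0 = x_n. *)
Definition rough_subembedding {R : realType} {X : metricType R} (C : R)
    (n : nat) (x : 'I_n -> X) (xb : 'I_n -> 'rV[R]_2) : Prop :=
  [/\ forall i, mdist (x (ordS i)) (x i) = eucl_dist (xb (ordS i)) (xb i),
      forall i j : 'I_n, i = 0%N :> nat -> (0 < j)%N ->
        mdist (x i) (x j) <= eucl_dist (xb i) (xb j)
    & forall i j : 'I_n, (0 < i)%N -> (0 < j)%N ->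
        mdist (x i) (x j) <= eucl_dist (xb i) (xb j) + C].

Definition rough_n_point {R : realType} (X : metricType R) (C : R) (n : nat)
    : Prop :=
  [/\ 0 <= C, (3 <= n)%N
    & forall x : 'I_n -> X,
        exists xb : 'I_n -> 'rV[R]_2, rough_subembedding C x xb].

(* Main.v *)
(* Both directions rest on explicit plane geometry.

   From the n-point condition to rCAT(0): apply the 5-point condition to the
   common vertex x, the two other vertices y, z and the two points u, v of the
   sides.  In the subembedding, u lies in the lens formed by the discs around x
   and y whose radii are the lengths of the two parts of the side, so it is
   within sqrt(9/8) of the point of the straight side that has the ratio of the
   comparison point; replacing the sides of the comparison triangle by the
   slightly longer ones of the subembedding costs at most 13/10.

   From rCAT(0) to the n-point condition: glue the comparison triangles of the
   fan (x_1, x_k, x_(k+1)) one after the other.  At each step one has a convex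
   polygon in the upper half-plane and a triangle in the lower one, sharing an
   edge I.  The two half-planes glued along I only (the "slit plane") form a
   CAT(0) space, whose distance dominates that of X up to C_0 per triangle.  If
   every vertex of the polygon sees the new vertex through I, the union is
   convex.  Otherwise, one end of I lies on a shortest path between its two
   neighbours; dropping it leaves a polygon with fewer vertices in a CAT(0)
   space, which is majorized by a convex one by induction, and the CAT(0)
   inequality allows the dropped vertex to be put back on an edge (this is
   Reshetnyak's majorization theorem, on vertices only). *)

Require Import Defs.
From HB Require Import structures.
From mathcomp Require Import all_boot all_order all_algebra.
From mathcomp Require Import all_classical all_reals all_analysis.
From mathcomp Require Import zify ring lra.

Set Implicit Arguments.
Unset Strict Implicit.
Unset Printing Implicit Defensive.

Import Order.TTheory GRing.Theory Num.Theory.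
Import numFieldNormedType.Exports.

Local Open Scope ring_scope.

(** * Plane geometry *)

Section Plane.
Variable R : rcfType.
Implicit Types (p q r m w : R * R) (l s t z : R).

Definition nm p : R := Num.sqrt (p.1 ^+ 2 + p.2 ^+ 2).
Definition dst p q : R := nm (p.1 - q.1, p.2 - q.2).
Definition comb s p q : R * R := ((1 - s) * p.1 + s * q.1, (1 - s) * p.2 + s * q.2).

Lemma ler_of_sqr (a b : R) : 0 <= b -> a ^+ 2 <= b ^+ 2 -> a <= b.
Proof.
move=> b0 ab; case: (leP a 0) => [a0|a0]; first exact: le_trans a0 b0.
by rewrite -ler_sqr // nnegrE // ltW.
Qed.

Lemma eqr_of_sqr (a b : R) : 0 <= a -> 0 <= b -> a ^+ 2 = b ^+ 2 -> a = b.
Proof.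
by move=> a0 b0 ab; apply/le_anti/andP; split; apply: ler_of_sqr; rewrite ?ab.
Qed.

Lemma nm_ge0 p : 0 <= nm p. Proof. exact: sqrtr_ge0. Qed.

Lemma nm_sq p : nm p ^+ 2 = p.1 ^+ 2 + p.2 ^+ 2.
Proof. by rewrite sqr_sqrtr // addr_ge0 // sqr_ge0. Qed.

Lemma dst_ge0 p q : 0 <= dst p q. Proof. exact: nm_ge0. Qed.

Lemma dst_sq p q : dst p q ^+ 2 = (p.1 - q.1) ^+ 2 + (p.2 - q.2) ^+ 2.
Proof. by rewrite nm_sq. Qed.

Lemma dstC p q : dst p q = dst q p.
Proof. by rewrite /dst /nm /=; congr Num.sqrt; ring. Qed.

Lemma dstxx p : dst p p = 0.
Proof. by rewrite /dst /nm /= !subrr expr0n addr0 sqrtr0. Qed.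

Lemma dst0 p : dst p (0, 0) = nm p.
Proof. by rewrite /dst /nm /= !subr0. Qed.

Lemma nm_axis z : 0 <= z -> nm (z, 0) = z.
Proof. by move=> z0; rewrite /nm /= expr0n addr0 sqrtr_sqr ger0_norm. Qed.

Lemma nm0 : nm (0, 0) = 0. Proof. exact: nm_axis. Qed.

Lemma nm_eq0 p : nm p = 0 -> p = (0, 0).
Proof.
move=> p0; have := nm_sq p; rewrite p0 expr0n => /esym/eqP.
by rewrite paddr_eq0 ?sqr_ge0 // !sqrf_eq0 => /andP[/eqP + /eqP]; case: p p0 => ? ? _ /= -> ->.
Qed.

Lemma dst_eq0 p q : dst p q = 0 -> p = q.
Proof.
case: p q => [a b] [c d] /nm_eq0 /= [] /eqP + /eqP.
by rewrite !subr_eq0 => /eqP-> /eqP->.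
Qed.

Lemma dot_le p q : p.1 * q.1 + p.2 * q.2 <= nm p * nm q.
Proof.
apply: ler_of_sqr; first by rewrite mulr_ge0 // nm_ge0.
rewrite exprMn !nm_sq; have := sqr_ge0 (p.1 * q.2 - p.2 * q.1); nra.
Qed.

Lemma dot_ge p q : - (nm p * nm q) <= p.1 * q.1 + p.2 * q.2.
Proof.
have := dot_le (- p.1, - p.2) q => /=.
have -> : nm (- p.1, - p.2) = nm p by rewrite /nm /= !sqrrN.
lra.
Qed.

Lemma fst_le_nm p : p.1 <= nm p.
Proof. by have := dot_le p (1, 0); rewrite nm_axis //=; lra. Qed.

Lemma fst_ge_nm p : - nm p <= p.1.
Proof. by have := dot_ge p (1, 0); rewrite nm_axis //=; lra. Qed.

Lemma nmD p q : nm (p.1 + q.1, p.2 + q.2) <= nm p + nm q.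
Proof.
apply: ler_of_sqr; first by rewrite addr_ge0 ?nm_ge0.
rewrite [X in _ <= X]sqrrD !nm_sq /=; have := dot_le p q; lra.
Qed.

Lemma dst_tri p q r : dst p q <= dst p r + dst r q.
Proof.
rewrite /dst; have := nmD (p.1 - r.1, p.2 - r.2) (r.1 - q.1, r.2 - q.2) => /=.
by rewrite !addrA !subrK.
Qed.

Lemma nmZ s p : 0 <= s -> nm (s * p.1, s * p.2) = s * nm p.
Proof.
move=> s0; apply: eqr_of_sqr; rewrite ?nm_ge0 ?mulr_ge0 ?nm_ge0 //.
by rewrite [RHS]exprMn !nm_sq /=; ring.
Qed.

(** Stewart's identity, the equality case of the inequality [cn_at] below. *)
Lemma dst_comb_sq s p q w :
  dst w (comb s p q) ^+ 2 =
  (1 - s) * dst w p ^+ 2 + s * dst w q ^+ 2 - s * (1 - s) * dst p q ^+ 2.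
Proof. by rewrite !dst_sq /=; ring. Qed.

Lemma dst_combl s p q : 0 <= s -> dst p (comb s p q) = s * dst p q.
Proof.
move=> s0; apply: eqr_of_sqr; rewrite ?dst_ge0 ?mulr_ge0 ?dst_ge0 //.
by rewrite exprMn !dst_sq /=; ring.
Qed.

Lemma dst_combr s p q : s <= 1 -> dst (comb s p q) q = (1 - s) * dst p q.
Proof.
move=> s1; apply: eqr_of_sqr; rewrite ?dst_ge0 ?mulr_ge0 ?subr_ge0 ?dst_ge0 //.
by rewrite exprMn !dst_sq /=; ring.
Qed.

Lemma triangle_exists (a b c : R) :
  0 <= a -> 0 <= b -> 0 <= c -> a <= b + c -> b <= a + c -> c <= a + b ->
  exists w, [/\ 0 <= w.2, nm w = b & dst (a, 0) w = c].
Proof.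
move=> a0 b0 c0 abc bac cab.
case: (eqVneq a 0) => [a00|an0].
  exists (b, 0); split=> //; first exact: nm_axis.
  have -> : c = b by lra.
  by rewrite a00 dstC dst0 nm_axis.
have ap : 0 < a by rewrite lt_def an0 a0.
(* The abscissa of the apex by the law of cosines; the triangle inequalities give
   [u ^+ 2 <= b ^+ 2]. *)
pose u := (a ^+ 2 + b ^+ 2 - c ^+ 2) / (2 * a).
have ua : 2 * a * u = a ^+ 2 + b ^+ 2 - c ^+ 2.
  by rewrite /u mulrC divfK // mulf_neq0 // pnatr_eq0.
have ub : u ^+ 2 <= b ^+ 2.
  have h1 : u <= b.
    suff : 2 * a * u <= 2 * a * b by rewrite ler_pM2l //; lra.
    rewrite ua; have : (a - b) ^+ 2 <= c ^+ 2 by nra.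
    by nra.
  have h2 : - b <= u.
    suff : 2 * a * (- b) <= 2 * a * u by rewrite ler_pM2l //; lra.
    rewrite ua; nra.
  nra.
have sq : Num.sqrt (b ^+ 2 - u ^+ 2) ^+ 2 = b ^+ 2 - u ^+ 2.
  by rewrite sqr_sqrtr // subr_ge0.
exists (u, Num.sqrt (b ^+ 2 - u ^+ 2)); split=> /=; first exact: sqrtr_ge0.
  by apply: eqr_of_sqr; rewrite ?nm_ge0 // nm_sq /= sq; ring.
apply: eqr_of_sqr; rewrite ?dst_ge0 // dst_sq /=.
by rewrite sub0r sqrrN sq; lra.
Qed.

(** These points form the sector of the upper half-plane with angles at most arccos [c]. For
    [c >= 0] the triangle inequality suffices; for [c < 0] the sector is cut out by a linear
    condition, [k] being the sine of the bounding angle. *)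
Lemma sector_convex (c : R) p q :
  -1 <= c <= 1 -> 0 <= p.2 -> 0 <= q.2 ->
  c * nm p <= p.1 -> c * nm q <= q.1 ->
  c * nm (p.1 + q.1, p.2 + q.2) <= p.1 + q.1.
Proof.
move=> /andP[c1 c1'] p2 q2 cp cq.
case: (leP 0 c) => [c0|c0].
  apply: le_trans (_ : c * (nm p + nm q) <= _); last by rewrite mulrDr lerD.
  by rewrite ler_wpM2l // nmD.
case: (leP 0 (p.1 + q.1)) => [|x0].
  by apply: le_trans; rewrite nmulr_rle0 // nm_ge0.
pose k := Num.sqrt (1 - c ^+ 2).
have k0 : 0 <= k by exact: sqrtr_ge0.
have k2 : k ^+ 2 = 1 - c ^+ 2 by rewrite sqr_sqrtr; nra.
have key r : 0 <= r.2 -> c * nm r <= r.1 -> - r.1 * k <= - c * r.2.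
  move=> r2 cr; case: (leP 0 r.1) => r1.
    by apply: le_trans (_ : 0 <= _); nra.
  apply: ler_of_sqr; first nra.
  rewrite !exprMn k2 !sqrrN; have := nm_sq r; have := nm_ge0 r.
  move: (nm r) cr => n cr n0 ns.
  have : r.1 ^+ 2 <= c ^+ 2 * n ^+ 2 by nra.
  rewrite ns; nra.
have kp := key _ p2 cp; have kq := key _ q2 cq.
set x := p.1 + q.1 in x0 *; set y := p.2 + q.2.
have y0 : 0 <= y by rewrite /y; lra.
have kx : - x * k <= - c * y by rewrite /x /y; lra.
suff : - x <= - c * nm (x, y) by lra.
apply: ler_of_sqr; first by rewrite mulr_ge0 ?nm_ge0; lra.
rewrite exprMn nm_sq /= !sqrrN.
have : (- x * k) ^+ 2 <= (- c * y) ^+ 2.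
  by rewrite ler_sqr ?nnegrE //; nra.
rewrite !exprMn k2 !sqrrN; nra.
Qed.

End Plane.

(** * CAT(0) pseudometric spaces and the slit plane *)

Section CAT0.
Variables (R : rcfType) (T : Type) (rho : T -> T -> R).

(** The Bruhat-Tits inequality at ratio [s]: Stewart's identity turned into an upper bound. With [w]
    equal to [p] or [q] it places [m] at ratio [s] between them. *)
Definition cn_at (p q : T) (s : R) (m : T) := forall w,
  rho w m ^+ 2 <= (1 - s) * rho w p ^+ 2 + s * rho w q ^+ 2
                  - s * (1 - s) * rho p q ^+ 2.

(** Points at distance zero may differ: gluing half-planes duplicates the points of the slit. *)
Definition pseudometric := [/\ forall p, rho p p = 0, forall p q, 0 <= rho p q,
  forall p q, rho p q = rho q p & forall p q r, rho p q <= rho p r + rho r q].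

Definition CAT0 := pseudometric /\
  forall p q s, 0 <= s <= 1 -> exists m, cn_at p q s m.

Hypothesis rhoP : pseudometric.

(** The point [m'] provided by CAT(0) at the same ratio is at distance zero from [m]: its inequality
    tested at [m] has right-hand side zero. *)
Lemma cn_between p q s m : CAT0 -> 0 <= s <= 1 ->
  rho p m = s * rho p q -> rho m q = (1 - s) * rho p q -> cn_at p q s m.
Proof.
case: rhoP => r0 rge rC rtri [_ cat] s01 pm mq w.
have [m' m'P] := cat p q s s01.
have mm' : rho m' m = 0.
  apply/eqP; rewrite -sqrf_eq0 eq_le sqr_ge0 andbT.
  have := m'P m; rewrite (rC m p) pm mq (rC m m') => /le_trans; apply.
  nra.
apply: le_trans (m'P w); rewrite ler_sqr ?nnegrE //.
by have := rtri w m m'; lra.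
Qed.

(* [z] and [z'] are allowed to differ: they will be two copies of a point of
   the gluing segment. *)
Lemma cn_at_concat p q t z z' : 0 <= t <= 1 ->
  rho p z = t * rho p q -> rho z' q = (1 - t) * rho p q ->
  (forall w, rho w z = rho w z') -> cn_at p q t z ->
  (forall s, 0 <= s <= 1 -> exists m, cn_at p z s m) ->
  (forall s, 0 <= s <= 1 -> exists m, cn_at z' q s m) ->
  forall s, 0 <= s <= 1 -> exists m, cn_at p q s m.
Proof.
case: rhoP => r0 rge rC rtri /andP[t0 t1] pz zq zz' cz cl cr s /andP[s0 s1].
case: (leP s t) => st.
  case: (eqVneq t 0) => tn0.
    by exists z; have -> : s = t by lra.
  have tp : 0 < t by rewrite lt_def tn0.
  have [|m mP] := cl (s / t).
    by rewrite divr_ge0 //= ler_pdivrMr // mul1r.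
  exists m => w; have := mP w; have := cz w; rewrite pz.
  have : s / t * t = s by rewrite divfK.
  have : 0 <= s / t by rewrite divr_ge0.
  move: (s / t) => a a0 <-.
  move: (rho w m) (rho w p) (rho w z) (rho w q) (rho p q) => m1 p1 z1 q1 c h1 h2.
  have := ler_wpM2l a0 h1; nra.
have tp : 0 < 1 - t by lra.
have [|m mP] := cr ((s - t) / (1 - t)).
  by rewrite divr_ge0 ?ler_pdivrMr //; lra.
exists m => w; have := mP w; have := cz w; rewrite zq -zz'.
have : (s - t) / (1 - t) * (1 - t) = s - t by rewrite divfK // gt_eqF.
have : (s - t) / (1 - t) <= 1 by rewrite ler_pdivrMr //; lra.
move: ((s - t) / (1 - t)) => a a1 at_.
have -> : s = t + a * (1 - t) by lra.
move: (rho w m) (rho w p) (rho w z) (rho w q) (rho p q) => m1 p1 z1 q1 c h1 h2.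
have a0 : 0 <= 1 - a by lra.
have := ler_wpM2l a0 h1; nra.
Qed.

End CAT0.

(** * Distances between opposite sides of a slit *)

Section SlitPlane.
Variable R : rcfType.
Implicit Types (p q r m w : R * R) (l s t z : R).

(* Points of the lower half-plane are represented by their mirror image, so
   [odst p q] is the planar distance between [p] and the mirror of [q]. *)
Definition odst p q : R := nm (p.1 - q.1, p.2 + q.2).

(** For nonzero points of the half-plane: the cosines of the angles with the positive axis have sum
    at most 0, that is, the angles add up to at least pi, and the shortest path turns at the
    origin. *)
Definition bent p q := p.1 * nm q + q.1 * nm p <= 0.

(** Reflection exchanging the two ends of the slit; it reduces turns at [(l, 0)] to turns at the
    origin. *)
Definition mir l p := (l - p.1, p.2).

Definition opp l p q : R :=
  if bent p q then nm p + nm q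
  else if bent (mir l p) (mir l q) then nm (mir l p) + nm (mir l q)
  else odst p q.

Lemma odst_sq p q : odst p q ^+ 2 = (p.1 - q.1) ^+ 2 + (p.2 + q.2) ^+ 2.
Proof. by rewrite nm_sq. Qed.

Lemma odst_ge0 p q : 0 <= odst p q. Proof. exact: nm_ge0. Qed.

Lemma odstC p q : odst p q = odst q p.
Proof. by rewrite /odst /nm /=; congr Num.sqrt; ring. Qed.

Lemma odst_axis z q : odst (z, 0) q = dst (z, 0) q.
Proof. by rewrite /odst /dst /nm /=; congr Num.sqrt; ring. Qed.

Lemma bentC p q : bent p q = bent q p.
Proof. by rewrite /bent addrC. Qed.

Lemma oppC l p q : opp l p q = opp l q p.
Proof.
by rewrite /opp bentC (bentC (mir l p)) odstC (addrC (nm p))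
  (addrC (nm (mir l p))).
Qed.

Lemma dst_mir l p q : dst (mir l p) (mir l q) = dst p q.
Proof. by rewrite /dst /nm /=; congr Num.sqrt; ring. Qed.

Lemma odst_mir l p q : odst (mir l p) (mir l q) = odst p q.
Proof. by rewrite /odst /nm /=; congr Num.sqrt; ring. Qed.

Lemma nm_mir l p : nm (mir l p) = dst p (l, 0).
Proof. by rewrite /dst /nm /=; congr Num.sqrt; ring. Qed.

Lemma odst_tri p q z : odst p q <= dst p (z, 0) + dst q (z, 0).
Proof.
have := nmD (p.1 - z, p.2) (z - q.1, q.2) => /=.
have -> : p.1 - z + (z - q.1) = p.1 - q.1 by ring.
move=> /le_trans; apply; apply: lerD.
  by rewrite /dst /= subr0.
by rewrite dstC /dst /nm /= sub0r sqrrN.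
Qed.

(** In [z], the right-hand side is convex, with nonnegative slope at the origin when the path is
    bent. The tangent bound for each distance, [key], is Cauchy-Schwarz for [r] and [r - (z, 0)]. *)
Lemma bent_min p q z : bent p q -> 0 <= z ->
  nm p + nm q <= dst p (z, 0) + dst q (z, 0).
Proof.
rewrite /bent => b z0.
case: (eqVneq (nm p) 0) => p0.
  by rewrite (nm_eq0 p0) nm0 add0r; have := dst_tri q (0,0) (z, 0);
     rewrite dst0 (dstC (z,0)); lra.
case: (eqVneq (nm q) 0) => q0.
  by rewrite (nm_eq0 q0) nm0 addr0; have := dst_tri p (0,0) (z, 0);
     rewrite dst0 (dstC (z,0)); lra.
have pp : 0 < nm p by rewrite lt_def p0 nm_ge0.
have qp : 0 < nm q by rewrite lt_def q0 nm_ge0.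
have key r : 0 < nm r -> nm r ^+ 2 - r.1 * z <= nm r * dst r (z, 0).
  move=> _; have := dot_le r (r.1 - z, r.2 - 0); rewrite /dst nm_sq /=.
  rewrite subr0; lra.
have kp := key _ pp; have kq := key _ qp.
have : nm p * nm q * (nm p + nm q) <=
       nm p * nm q * (dst p (z, 0) + dst q (z, 0)).
  move: (dst p _) (dst q _) kp kq => a c; move: (nm p) (nm q) pp qp b => x y *.
  have h1 : y * (x ^+ 2 - p.1 * z) <= y * (x * a) by rewrite ler_pM2l.
  have h2 : x * (y ^+ 2 - q.1 * z) <= x * (y * c) by rewrite ler_pM2l.
  nra.
by rewrite ler_pM2l // mulr_gt0.
Qed.

Lemma opp_ge l p q : odst p q <= opp l p q.
Proof.
rewrite /opp; case: ifP => _.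
  by have := odst_tri p q 0; rewrite !dst0.
by case: ifP => // _; rewrite !nm_mir; exact: odst_tri.
Qed.

Lemma opp_ge0 l p q : 0 <= opp l p q.
Proof. exact: le_trans (odst_ge0 _ _) (opp_ge _ _ _). Qed.

Lemma opp_min l p q z : 0 <= z <= l -> opp l p q <= dst p (z, 0) + dst q (z, 0).
Proof.
move=> /andP[z0 zl]; rewrite /opp; case: ifP => b; first exact: bent_min.
case: ifP => b'; last exact: odst_tri.
have := @bent_min _ _ (l - z) b'; rewrite subr_ge0 => /(_ zl) /le_trans; apply.
have -> : (l - z, 0) = mir l (z, 0) by [].
by rewrite !dst_mir.
Qed.

Lemma opp_bent l p q : bent p q -> opp l p q = nm p + nm q.
Proof. by rewrite /opp => ->. Qed.

(** The definition of [opp] tests the origin first. If the path is bent at both ends, [bent_min]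
    used in both directions shows that the two values agree. *)
Lemma opp_bent_mir l p q : 0 <= l -> bent (mir l p) (mir l q) ->
  opp l p q = nm (mir l p) + nm (mir l q).
Proof.
move=> l0 b'; rewrite /opp b'; case: ifP => // b; apply/le_anti/andP; split.
  by rewrite !nm_mir; exact: bent_min.
apply: le_trans (bent_min b' l0) _.
have -> : (l, 0) = mir l (0, 0) by rewrite /mir /= subr0.
by rewrite !dst_mir !dst0.
Qed.

(** Without a bend the two angles have sum below pi, and the expression is the sine of that sum
    times [nm p * nm q]. Its sign puts the crossing point of the straight segment at a nonnegative
    abscissa. *)
Lemma visible_cross p q : 0 <= p.2 -> 0 <= q.2 -> ~~ bent p q ->
  0 <= p.1 * q.2 + q.1 * p.2.
Proof.
rewrite /bent -ltNge => p2 q2 h.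
have key a b : 0 <= a.2 -> 0 <= b.2 -> a.1 < 0 -> 0 < a.1 * nm b + b.1 * nm a ->
    0 <= a.1 * b.2 + b.1 * a.2.
  move=> a2 b2 a1 hh.
  have na := nm_ge0 a; have nb := nm_ge0 b; have sa := nm_sq a; have sb := nm_sq b.
  have b1 : 0 <= b.1 by nra.
  suff : - a.1 * b.2 <= b.1 * a.2 by lra.
  apply: ler_of_sqr; first by rewrite mulr_ge0.
  have : (- a.1 * nm b) ^+ 2 <= (b.1 * nm a) ^+ 2.
    by rewrite ler_sqr ?nnegrE; nra.
  by rewrite !exprMn sa sb; nra.
case: (leP 0 p.1) => p1; last exact: key.
case: (leP 0 q.1) => q1; first by rewrite addr_ge0 // mulr_ge0.
by rewrite addrC; apply: key => //; rewrite addrC.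
Qed.

Lemma visible_axis p q : p.2 = 0 -> q.2 = 0 -> ~~ bent p q -> 0 <= p.1 /\ 0 <= q.1.
Proof.
rewrite /bent -ltNge => p2 q2.
have nmE a : a.2 = 0 -> nm a = `|a.1|.
  by move=> a2; rewrite /nm a2 expr0n addr0 sqrtr_sqr.
rewrite !nmE // => h; split; case: leP => // c; move: h; rewrite ltNge.
  by rewrite (ltr0_norm c); have := ler_norm q.1; have := normr_ge0 q.1; nra.
by rewrite (ltr0_norm c); have := ler_norm p.1; have := normr_ge0 p.1; nra.
Qed.

(* The case analysis returns the point of the slit through which a shortest
   path from the upper point [p] to the lower point [q] goes. *)
Lemma opp_attained l p q : 0 <= l -> 0 <= p.2 -> 0 <= q.2 ->
  exists2 z, 0 <= z <= l & opp l p q = dst p (z, 0) + dst q (z, 0) /\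
   [\/ bent p q /\ z = 0, bent (mir l p) (mir l q) /\ z = l |
    opp l p q = odst p q /\ exists2 t, 0 <= t <= 1 &
      [/\ (z, 0) = comb t p (q.1, - q.2), dst p (z, 0) = t * odst p q &
          dst q (z, 0) = (1 - t) * odst p q]].
Proof.
move=> l0 p2 q2; case: (boolP (bent p q)) => b.
  by exists 0; [rewrite lexx | rewrite opp_bent // !dst0; split => //; constructor 1].
case: (boolP (bent (mir l p) (mir l q))) => b'.
  exists l; [by rewrite l0 lexx | rewrite opp_bent_mir // !nm_mir; split => //].
  by constructor 2.
have oE : opp l p q = odst p q by rewrite /opp (negbTE b) (negbTE b').
(* If both points lie on the axis, the crossing point is not determined, and [p] is chosen. *)
case: (eqVneq (p.2 + q.2) 0) => s0.
  have p20 : p.2 = 0 by lra.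
  have q20 : q.2 = 0 by lra.
  have [p1 q1] := visible_axis p20 q20 b.
  have [] := visible_axis _ _ b' => //= p1' q1'.
  exists p.1; first by apply/andP; split; lra.
  have zp : (p.1, 0) = p by case: p p20 {p2 s0 b b' oE p1 p1'} => ? ? /= ->.
  have dE : dst q p = odst p q by rewrite dstC /dst /odst p20 q20 addr0 subr0.
  rewrite zp dstxx add0r oE dE; split=> //.
  constructor 3; split=> //; exists 0; rewrite ?lexx ?ler01 // subr0 mul1r mul0r.
  by split=> //; rewrite /comb -{1}zp p20 /=; congr pair; ring.
have sp : 0 < p.2 + q.2 by rewrite lt_def s0 addr_ge0.
(* The ratio at which the segment from [p] to the mirror image of [q] meets the axis; [z] below is
   the abscissa. *)
pose t : R := p.2 / (p.2 + q.2).
have tE : t * (p.2 + q.2) = p.2 by rewrite divfK.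
have t0 : 0 <= t by rewrite divr_ge0 // ltW.
have t1 : t <= 1 by rewrite ler_pdivrMr // mul1r lerDl.
clearbody t; have tq : (1 - t) * p.2 = t * q.2 by lra.
pose z : R := (1 - t) * p.1 + t * q.1.
have zE : z * (p.2 + q.2) = p.1 * q.2 + q.1 * p.2.
  by rewrite /z mulrDl -!mulrA ![_ * (p.2 + q.2)]mulrC !mulrA
    mulrBl mul1r tE; lra.
have z0 : 0 <= z.
  by rewrite -(pmulr_lge0 _ sp) zE; exact: visible_cross.
have zl : z <= l.
  rewrite -subr_ge0 -(pmulr_lge0 _ sp).
  by have := @visible_cross (mir l p) (mir l q) p2 q2 b'; rewrite /=; lra.
have d1 : dst p (z, 0) = t * odst p q.
  apply: eqr_of_sqr; rewrite ?dst_ge0 ?mulr_ge0 ?odst_ge0 //.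
    rewrite exprMn odst_sq dst_sq /= subr0 -{1}tE /z; ring.
have d2 : dst q (z, 0) = (1 - t) * odst p q.
  apply: eqr_of_sqr; rewrite ?dst_ge0 ?mulr_ge0 ?odst_ge0 ?subr_ge0 //.
  have q2E : q.2 = (1 - t) * (p.2 + q.2) by lra.
  rewrite exprMn odst_sq dst_sq /= subr0 {1}q2E /z; ring.
exists z; first by rewrite z0.
rewrite d1 d2 oE; split; first by ring.
constructor 3; split=> //; exists t; first by rewrite t0.
by split=> //; rewrite /comb /=; congr pair; lra.
Qed.

(* If the shortest path between [m] and [w] turns at the origin, then
   [p |-> (rho p w ^+ 2 - |p|^2 - |w|^2) / 2] is supported at [m] by the linear
   form [p |-> |w| (m / |m|) . p]; this is what makes it convex. *)
Lemma bent_support m w p (r : R) : 0 <= m.2 -> 0 <= w.2 -> 0 <= p.2 ->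
  bent m w -> odst p w <= r -> (bent p w -> nm p + nm w <= r) ->
  nm m * (nm p ^+ 2 + nm w ^+ 2) + 2 * nm w * (m.1 * p.1 + m.2 * p.2)
    <= nm m * r ^+ 2.
Proof.
move=> m2 w2 p2 bm rv rb.
have nm_ := nm_ge0 m; have nw := nm_ge0 w; have np := nm_ge0 p.
have sm := nm_sq m; have sw := nm_sq w; have sp := nm_sq p.
case: (boolP (bent p w)) => bp.
  have hr := rb bp.
  have : (nm p + nm w) ^+ 2 <= r ^+ 2 by rewrite ler_sqr ?nnegrE; lra.
  have := dot_le m p; move: (m.1 * p.1 + m.2 * p.2) => d hd hr2.
  have := ler_wpM2l nm_ hr2; nra.
have r2 : odst p w ^+ 2 <= r ^+ 2.
  by rewrite ler_sqr ?nnegrE ?odst_ge0 //; apply: le_trans rv; exact: odst_ge0.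
have := ler_wpM2l nm_ r2; apply: le_trans.
suff : p.1 * (nm m * w.1 + nm w * m.1) + p.2 * (- nm m * w.2 + nm w * m.2) <= 0.
  by rewrite odst_sq sp sw; nra.
have vc := visible_cross p2 w2 bp.
move: bm bp; rewrite /bent -ltNge => bm bp.
have dmw : - (nm m * nm w) <= m.1 * w.1 - m.2 * w.2.
  by have := dot_ge m (w.1, - w.2); rewrite /= [nm (_, _)]/nm /= sqrrN -/(nm w); lra.
(* Off the axis, multiplying by [w.2] exhibits a product of factors of opposite signs, by visibility
   of [p] and bending at [m], minus a nonnegative term. *)
case: (eqVneq w.2 0) => w20; last first.
  have w2p : 0 < w.2 by rewrite lt_def w20.
  rewrite -(pmulr_lle0 _ w2p).
  have -> : (p.1 * (nm m * w.1 + nm w * m.1) + p.2 * (- nm m * w.2 + nm w * m.2)) * w.2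
     = (p.1 * w.2 + w.1 * p.2) * (m.1 * nm w + w.1 * nm m)
       - p.2 * (nm w * (nm m * nm w + (m.1 * w.1 - m.2 * w.2))).
    have -> : nm w * (nm m * nm w + (m.1 * w.1 - m.2 * w.2)) =
       nm m * nm w ^+ 2 + nm w * (m.1 * w.1 - m.2 * w.2) by ring.
    by rewrite sw; ring.
  rewrite subr_le0; apply: (@le_trans _ _ 0).
    by rewrite mulr_ge0_le0.
  by rewrite !mulr_ge0 //; lra.
have nwE : nm w = `|w.1| by rewrite /nm w20 expr0n addr0 sqrtr_sqr.
rewrite w20 mulr0 add0r.
case: (ltP w.1 0) => w1.
  have := fst_le_nm p; rewrite nwE (ltr0_norm w1) in bp *; nra.
rewrite nwE (ger0_norm w1) in bm *.
have fm := fst_ge_nm m.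
case: (eqVneq w.1 0) => w10; first by rewrite w10; lra.
have w1p : 0 < w.1 by rewrite lt_def w10.
have m1 : m.1 = - nm m.
  apply/le_anti; rewrite fm andbT.
  by have : w.1 * (m.1 + nm m) <= 0 by [lra]; rewrite pmulr_rle0 //; lra.
have m20 : m.2 = 0.
  by apply/eqP; rewrite -sqrf_eq0; apply/eqP; rewrite m1 sqrrN in sm; lra.
by rewrite m20 m1; nra.
Qed.

(** [bent_support] is averaged over [p] and [q] with weights [1 - s] and [s]. As [m] is the same
    average, the linear terms add up to [nm m ^+ 2], and a factor [nm m] cancels. *)
Lemma bent_convex p q w s (rp rq : R) : let m := comb s p q in
  0 <= s <= 1 -> 0 <= w.2 -> 0 <= p.2 -> 0 <= q.2 -> bent m w -> 0 < nm m ->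
  odst p w <= rp -> (bent p w -> nm p + nm w <= rp) ->
  odst q w <= rq -> (bent q w -> nm q + nm w <= rq) ->
  (nm m + nm w) ^+ 2 <= (1 - s) * rp ^+ 2 + s * rq ^+ 2 - s * (1 - s) * dst p q ^+ 2.
Proof.
move=> m /andP[s0 s1] w2 p2 q2 bm mp hp hp' hq hq'.
have m2 : 0 <= m.2 by rewrite addr_ge0 // mulr_ge0 // subr_ge0.
have := bent_support m2 w2 p2 bm hp hp'.
have := bent_support m2 w2 q2 bm hq hq'.
have s1' : 0 <= 1 - s by lra.
move=> /(ler_wpM2l s0) h1 /(ler_wpM2l s1') h2.
rewrite -(ler_pM2l mp).
have : nm m ^+ 2 = (1 - s) * nm p ^+ 2 + s * nm q ^+ 2 - s * (1 - s) * dst p q ^+ 2.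
  by rewrite !nm_sq /=; ring.
have : nm m ^+ 2 = (1 - s) * (m.1 * p.1 + m.2 * p.2) + s * (m.1 * q.1 + m.2 * q.2).
  by rewrite nm_sq /=; ring.
move: (m.1 * p.1 + m.2 * p.2) (m.1 * q.1 + m.2 * q.2) h1 h2 => a b.
move: (nm m) mp => x xp.
move: (nm w) (nm p) (nm q) (dst p q) => y u v d h1 h2 e1 e2.
have e1y : 2 * y * x ^+ 2 = 2 * y * ((1 - s) * a + s * b) by rewrite -e1.
have e2x : x * x ^+ 2 = x * ((1 - s) * u ^+ 2 + s * v ^+ 2 - s * (1 - s) * d ^+ 2).
  by rewrite -e2.
nra.
Qed.

(** A straight path from [m] to [w] reduces to Stewart's identity, with [odst <= opp] at the ends; a
    bent one is [bent_convex], up to reflection. *)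
Lemma opp_convex l p q w s : 0 <= l -> 0 <= s <= 1 ->
  0 <= w.2 -> 0 <= p.2 -> 0 <= q.2 ->
  opp l (comb s p q) w ^+ 2 <=
  (1 - s) * opp l p w ^+ 2 + s * opp l q w ^+ 2 - s * (1 - s) * dst p q ^+ 2.
Proof.
move=> l0 s01 w2 p2 q2; have /andP[s0 s1] := s01.
set m := comb s p q.
have vis : opp l m w = odst m w -> opp l m w ^+ 2 <=
    (1 - s) * opp l p w ^+ 2 + s * opp l q w ^+ 2 - s * (1 - s) * dst p q ^+ 2.
  move=> ->.
  have hp : odst p w ^+ 2 <= opp l p w ^+ 2.
    by rewrite ler_sqr ?nnegrE ?odst_ge0 ?opp_ge0 ?opp_ge.
  have hq : odst q w ^+ 2 <= opp l q w ^+ 2.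
    by rewrite ler_sqr ?nnegrE ?odst_ge0 ?opp_ge0 ?opp_ge.
  have -> : odst m w ^+ 2 = (1 - s) * odst p w ^+ 2 + s * odst q w ^+ 2
      - s * (1 - s) * dst p q ^+ 2 by rewrite !odst_sq dst_sq /=; ring.
  have s1' : 0 <= 1 - s by lra.
  by have := ler_wpM2l s1' hp; have := ler_wpM2l s0 hq; lra.
case: (boolP (bent m w)) => b.
  case: (eqVneq (nm m) 0) => m0.
    apply: vis; rewrite opp_bent // m0 (nm_eq0 m0) add0r odst_axis dstC dst0 //.
  rewrite opp_bent //; apply: bent_convex => //.
  - by rewrite lt_def m0 nm_ge0.
  - exact: opp_ge.
  - by move=> /opp_bent ->.
  - exact: opp_ge.
  - by move=> /opp_bent ->.
case: (boolP (bent (mir l m) (mir l w))) => b'; last first.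
  by apply: vis; rewrite /opp (negbTE b) (negbTE b').
have mE : mir l m = comb s (mir l p) (mir l q).
  by rewrite /m /comb /mir /=; congr pair; ring.
case: (eqVneq (nm (mir l m)) 0) => m0.
  apply: vis; rewrite opp_bent_mir // m0 add0r -(odst_mir l) (nm_eq0 m0).
  by rewrite odst_axis dstC dst0.
rewrite opp_bent_mir // -(dst_mir l p) mE; apply: bent_convex => //.
- by rewrite -mE.
- by rewrite -mE lt_def m0 nm_ge0.
- by rewrite odst_mir opp_ge.
- by move=> /(opp_bent_mir l0) ->.
- by rewrite odst_mir opp_ge.
- by move=> /(opp_bent_mir l0) ->.
Qed.

Lemma opp_axis l z q : 0 <= z <= l -> opp l (z, 0) q = dst (z, 0) q.
Proof.
move=> zl; apply/le_anti/andP; split.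
  by have := opp_min (z, 0) q zl; rewrite dstxx add0r dstC.
by rewrite -odst_axis opp_ge.
Qed.

Lemma opp_tri l p q r : 0 <= l -> 0 <= p.2 -> 0 <= q.2 -> 0 <= r.2 ->
  dst p q <= opp l p r + opp l r q /\ opp l p q <= dst p r + opp l r q.
Proof.
move=> l0 p2 q2 r2; split.
  have := opp_ge l p r; have := opp_ge l r q.
  have := nmD (p.1 - r.1, p.2 + r.2) (r.1 - q.1, - (r.2 + q.2)).
  rewrite /= -/(odst p r).
  have -> : nm (r.1 - q.1, - (r.2 + q.2)) = odst r q.
    by rewrite /odst /nm /= sqrrN.
  have -> : nm (p.1 - r.1 + (r.1 - q.1), p.2 + r.2 - (r.2 + q.2)) = dst p q.
    by rewrite /dst; congr nm; congr pair; ring.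
  lra.
have [z zl [-> _]] := opp_attained l0 r2 q2.
have := opp_min p q zl; have := dst_tri p (z, 0) r; lra.
Qed.

(** Both inequalities are [cn_at] at the crossing point, of ratio [c1 / (c1 + c2)], cleared of
    denominators: first for [w] on the side of [p], then for [w] on the side of [q]. *)
Lemma opp_bend l p q : 0 <= l -> 0 <= p.2 -> 0 <= q.2 ->
  exists2 z, 0 <= z <= l &
   let c1 := dst p (z, 0) in let c2 := dst q (z, 0) in
   [/\ opp l p q = c1 + c2,
    forall w, 0 <= w.2 -> (c1 + c2) * (dst w (z, 0) ^+ 2 + c1 * c2) <=
      c2 * dst w p ^+ 2 + c1 * opp l w q ^+ 2 &
    forall w, 0 <= w.2 -> (c1 + c2) * (dst w (z, 0) ^+ 2 + c1 * c2) <=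
      c2 * opp l w p ^+ 2 + c1 * dst w q ^+ 2].
Proof.
move=> l0 p2 q2; have [z zl [oE cs]] := opp_attained l0 p2 q2.
exists z => // c1 c2.
have bent_case a b w (r : R) : bent a b -> 0 <= a.2 -> 0 <= b.2 -> 0 <= w.2 ->
    odst w b <= r -> (bent w b -> nm w + nm b <= r) ->
    (nm a + nm b) * (nm w ^+ 2 + nm a * nm b) <= nm b * dst w a ^+ 2 + nm a * r ^+ 2.
  move=> bab a2 b2 w2 h1 h2; have := bent_support a2 b2 w2 bab h1 h2.
  have -> : dst w a ^+ 2 = nm w ^+ 2 + nm a ^+ 2 - 2 * (a.1 * w.1 + a.2 * w.2).
    by rewrite dst_sq !nm_sq; ring.
  nra.
case: cs => [[b z0]|[b zl']|[oo [t /andP[t0 t1] [zE c1E c2E]]]].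
- split=> // w w2; rewrite /c1 /c2 z0 !dst0.
    apply: bent_case => //; first exact: opp_ge.
    by move=> /opp_bent ->.
  rewrite (addrC (nm p)) (mulrC (nm p) (nm q)) [X in _ <= X]addrC.
  apply: bent_case => //.
  - by rewrite bentC.
  - exact: opp_ge.
  - by move=> /opp_bent ->.
- split=> // w w2; rewrite /c1 /c2 zl' -!nm_mir.
    rewrite -(dst_mir l w p); apply: bent_case => //.
      by rewrite odst_mir; exact: opp_ge.
    by move=> /(opp_bent_mir l0) ->.
  rewrite (addrC (nm (mir l p))) (mulrC (nm (mir l p)) (nm (mir l q))).
  rewrite [X in _ <= X]addrC -(dst_mir l w q).
  apply: bent_case => //.
  - by rewrite bentC.
  - by rewrite odst_mir; exact: opp_ge.
  - by move=> /(opp_bent_mir l0) ->.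
have c0 := odst_ge0 p q.
have odstE a b : odst a b = dst a (b.1, - b.2) by rewrite /dst /= opprK.
have vis a b w (r : R) u : (z, 0) = comb u a (b.1, - b.2) -> 0 <= u <= 1 ->
    odst w b <= r -> odst p q = odst a b ->
    (u * odst p q + (1 - u) * odst p q) *
      (dst w (z, 0) ^+ 2 + u * odst p q * ((1 - u) * odst p q)) <=
    (1 - u) * odst p q * dst w a ^+ 2 + u * odst p q * r ^+ 2.
  move=> -> /andP[u0 u1] hr abE; rewrite dst_comb_sq -!odstE -abE.
  have : odst w b ^+ 2 <= r ^+ 2.
    by rewrite ler_sqr ?nnegrE ?odst_ge0 //; apply: le_trans hr; exact: odst_ge0.
  have uc : 0 <= u * odst p q by rewrite mulr_ge0.
  by move=> /(ler_wpM2l uc); nra.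
split=> // w w2; rewrite /c1 /c2 c1E c2E.
  by apply: vis zE _ _ _; rewrite ?t0 ?t1 ?opp_ge.
have zE' : (z, 0) = comb (1 - t) q (p.1, - p.2).
  by move: zE; rewrite /comb /= => -[-> e]; congr pair; lra.
have := vis q p w (opp l w p) _ zE'; rewrite subKr => h.
have /h {}h : 0 <= 1 - t <= 1 by apply/andP; split; lra.
have := h (opp_ge _ _ _) (odstC _ _); lra.
Qed.

End SlitPlane.

(** * The slit plane as a CAT(0) space *)

Section SlitCAT0.
Variable R : rcfType.
Implicit Types (l s z : R) (p q : R * R) (x y : bool * (R * R)).

Definition fold p : R * R := (p.1, `|p.2|).

(* Two half-planes (upper for [true], lower for [false]) glued along the
   segment [0, l] of the axis; [fold] makes every pair a legitimate point. *)
Definition slit l x y : R :=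
  if x.1 == y.1 then dst (fold x.2) (fold y.2) else opp l (fold x.2) (fold y.2).

Lemma fold_id p : 0 <= p.2 -> fold p = p.
Proof. by case: p => a b /= b0; rewrite /fold /= ger0_norm. Qed.

Lemma fold_ge0 p : 0 <= (fold p).2. Proof. exact: normr_ge0. Qed.

Lemma slitC l x y : slit l x y = slit l y x.
Proof. by rewrite /slit eq_sym dstC oppC. Qed.

Lemma slit_axis l b z x : 0 <= z <= l -> slit l x (b, (z, 0)) = dst (fold x.2) (z, 0).
Proof.
move=> zl; rewrite /slit /= (@fold_id (z, 0)) //=; case: ifP => // _.
by rewrite oppC opp_axis // dstC.
Qed.

Lemma slit_pseudometric l : 0 <= l -> pseudometric (slit l).
Proof.
move=> l0; split.
- by move=> x; rewrite /slit eqxx dstxx.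
- by move=> x y; rewrite /slit; case: ifP => _; rewrite ?dst_ge0 ?opp_ge0.
- exact: slitC.
move=> [b p] [c q] [d r]; rewrite /slit /=.
have p2 := fold_ge0 p; have q2 := fold_ge0 q; have r2 := fold_ge0 r.
have tri := dst_tri (fold p) (fold q) (fold r).
have [t1 t2] := opp_tri l0 p2 q2 r2.
have [_] := opp_tri l0 q2 p2 r2.
rewrite (oppC _ (fold q) (fold p)) (oppC _ (fold r) (fold p)).
rewrite (dstC (fold q) (fold r)) => t3.
by case: b c d => [] [] [] //=; lra.
Qed.

Lemma slit_cn_side l b p q s : 0 <= l -> 0 <= s <= 1 ->
  exists m, cn_at (slit l) (b, p) (b, q) s m.
Proof.
move=> l0 s01; have /andP[s0 s1] := s01.
have p2 := fold_ge0 p; have q2 := fold_ge0 q.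
exists (b, comb s (fold p) (fold q)) => -[c w]; rewrite /slit /= eqxx.
rewrite (@fold_id (comb _ _ _)); last first.
  by rewrite addr_ge0 // mulr_ge0 // subr_ge0.
case: ifP => _; first by rewrite dst_comb_sq.
rewrite !(oppC _ (fold w)); apply: opp_convex => //; exact: fold_ge0.
Qed.

(** On one side, straight segments do. Across the slit, two of them are concatenated at the crossing
    point, whose two copies have the same distances to all points. *)
Theorem slit_CAT0 l : 0 <= l -> CAT0 (slit l).
Proof.
move=> l0; have sm := slit_pseudometric l0; split=> //.
move=> [b p] [c q] s s01; case: (eqVneq b c) => [<-|bc].
  exact: slit_cn_side.
have p2 := fold_ge0 p; have q2 := fold_ge0 q.
have [z zl /= [oE up dn]] := opp_bend l0 p2 q2.
have pqE : slit l (b, p) (c, q) = opp l (fold p) (fold q).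
  by rewrite /slit /= (negbTE bc).
set c1 := dst (fold p) (z, 0) in oE up dn.
set c2 := dst (fold q) (z, 0) in oE up dn.
have c10 : 0 <= c1 by exact: dst_ge0.
have c20 : 0 <= c2 by exact: dst_ge0.
(* If [c1 + c2 = 0] there is no ratio to take, but the two points are at distance zero and either
   one serves as [m]. *)
case: (eqVneq (c1 + c2) 0) => d0.
  case: sm => _ sge sC stri; exists (b, p) => w.
  rewrite pqE oE d0 expr0n mulr0 subr0.
  have : slit l w (b, p) ^+ 2 <= slit l w (c, q) ^+ 2.
    rewrite ler_sqr ?nnegrE ?sge //.
    by have := stri w (b, p) (c, q); rewrite (sC (c, q)) pqE oE d0 addr0.
  by case/andP: s01 => s0 _ /(ler_wpM2l s0); lra.
have dp : 0 < c1 + c2 by rewrite lt_def d0 addr_ge0.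
have t01 : 0 <= c1 / (c1 + c2) <= 1.
  by rewrite divr_ge0 ?(ltW dp) //= ler_pdivrMr // mul1r lerDl.
have tE : c1 / (c1 + c2) * (c1 + c2) = c1 by rewrite divfK.
move: (c1 / (c1 + c2)) t01 tE => t t01 tE.
have zz w : slit l w (b, (z, 0)) = slit l w (c, (z, 0)) by rewrite !slit_axis.
apply: (cn_at_concat sm (t := t) (z := (b, (z, 0))) (z' := (c, (z, 0)))) => //.
- by rewrite pqE oE slit_axis // -/c1 tE.
- by rewrite slitC pqE oE slit_axis // -/c2; lra.
- move=> [e w]; rewrite pqE oE slit_axis //=.
  have w2 := fold_ge0 w.
  have {up} := up _ w2; have {dn} := dn _ w2.
  have : c2 = (1 - t) * (c1 + c2) by lra.
  move: tE; set d := c1 + c2 => <- -> dn up.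
  rewrite -(ler_pM2l dp) -/d.
  have [ebE ecE] : (e == b -> slit l (e, w) (b, p) = dst (fold w) (fold p) /\
       slit l (e, w) (c, q) = opp l (fold w) (fold q)) /\
     (e != b -> slit l (e, w) (b, p) = opp l (fold w) (fold p) /\
       slit l (e, w) (c, q) = dst (fold w) (fold q)).
    by rewrite /slit /=; case: b c e bc {pqE zz} => [] [] [].
  by case: (boolP (e == b)) => [/ebE|/ecE] [-> ->]; lra.
- by move=> *; exact: slit_cn_side.
- by move=> *; exact: slit_cn_side.
Qed.

End SlitCAT0.

(** * Majorization of polygons *)

Section Extreme.
Variable R : rcfType.
Implicit Types (v p q w : R * R) (l s : R).

(* In the upper half-plane: the angle of [v] with the positive axis is at least
   that of [p].  Always true for [v = 0] and for [p = 0]. *)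
Definition extreme v p := v.1 * nm p <= p.1 * nm v.

Lemma extreme_refl v : extreme v v. Proof. exact: lexx. Qed.

Lemma extreme0 v : extreme v (0, 0).
Proof. by rewrite /extreme nm0 mulr0 mul0r. Qed.

Lemma extreme_axis v s : 0 <= s -> extreme v (s, 0).
Proof.
by move=> s0; rewrite /extreme nm_axis //= mulrC ler_wpM2l // fst_le_nm.
Qed.

Lemma extreme_neg_axis s p : 0 <= s -> extreme (- s, 0) p.
Proof.
move=> s0; rewrite /extreme.
have -> : nm (- s, 0) = s by rewrite -[RHS](nm_axis s0) /nm /= sqrrN.
by have := ler_wpM2l s0 (fst_ge_nm p); rewrite /=; lra.
Qed.

Lemma extremeZl s v p : 0 <= s -> extreme v p -> extreme (s * v.1, s * v.2) p.
Proof.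
by rewrite /extreme => s0 /(ler_wpM2l s0); rewrite nmZ //=; lra.
Qed.

Lemma extremeZr s v p : 0 < s -> extreme v (s * p.1, s * p.2) -> extreme v p.
Proof.
move=> s0; rewrite /extreme nmZ ?(ltW s0) //=.
have -> : v.1 * (s * nm p) = s * (v.1 * nm p) by ring.
by rewrite -mulrA ler_pM2l.
Qed.

Lemma extreme_comb s v p q : 0 <= s <= 1 -> 0 <= p.2 -> 0 <= q.2 ->
  extreme v p -> extreme v q -> extreme v (comb s p q).
Proof.
move=> /andP[s0 s1] p2 q2.
case: (eqVneq (nm v) 0) => v0; first by rewrite /extreme v0 (nm_eq0 v0) !mulr0 !mul0r.
have vp : 0 < nm v by rewrite lt_def v0 nm_ge0.
have extE r : extreme v r = (v.1 / nm v * nm r <= r.1).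
  by rewrite /extreme mulrAC ler_pdivrMr.
rewrite !extE => hp hq; have s1' : 0 <= 1 - s by lra.
apply: (@sector_convex _ _ ((1 - s) * p.1, (1 - s) * p.2) (s * q.1, s * q.2)).
- by rewrite ler_pdivlMr // ler_pdivrMr // mulN1r mul1r fst_le_nm fst_ge_nm.
- exact: mulr_ge0.
- exact: mulr_ge0.
- by rewrite nmZ // mulrCA ler_wpM2l.
- by rewrite nmZ // mulrCA ler_wpM2l.
Qed.

(** A smaller angle keeps the sum of angles below pi. The origin is excluded since it is bent with
    every point. *)
Lemma extreme_visible v p w : extreme v p -> nm p != 0 ->
  ~~ bent v w -> ~~ bent p w.
Proof.
rewrite /extreme /bent -!ltNge => e p0 b.
have pp : 0 < nm p by rewrite lt_def p0 nm_ge0.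
have v0 := nm_ge0 v; have w0 := nm_ge0 w.
have vp : 0 < nm v.
  rewrite lt_def v0 andbT; apply: contraTneq b => vz.
  by rewrite vz (nm_eq0 vz) mul0r mulr0 addr0 ltxx.
rewrite -(pmulr_rgt0 _ vp); apply: lt_le_trans (_ : nm p * (v.1 * nm w + w.1 * nm v) <= _).
  exact: mulr_gt0.
by have := ler_wpM2l w0 e; lra.
Qed.

(** Multiplication by [w / nm w] in the complex plane; it brings the mirror image of [w] onto the
    positive axis. *)
Definition rot w p : R * R :=
  ((p.1 * w.1 - p.2 * w.2) / nm w, (p.1 * w.2 + p.2 * w.1) / nm w).

Lemma dst_rot w p q : nm w != 0 -> dst (rot w p) (rot w q) = dst p q.
Proof.
move=> w0; apply: eqr_of_sqr; rewrite ?dst_ge0 // !dst_sq /=.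
have sw := nm_sq w.
transitivity (((p.1 - q.1) ^+ 2 + (p.2 - q.2) ^+ 2) * ((w.1 ^+ 2 + w.2 ^+ 2) / nm w ^+ 2)).
  by field.
by rewrite -sw divff ?mulr1 // expf_neq0.
Qed.

Lemma rot0 w : rot w (0, 0) = (0, 0).
Proof. by rewrite /rot /= !mul0r subrr addr0 mul0r. Qed.

Lemma nm_rot w p : nm w != 0 -> nm (rot w p) = nm p.
Proof. by move=> w0; rewrite -dst0 -(rot0 w) dst_rot // dst0. Qed.

Lemma rot_conj w : nm w != 0 -> rot w (w.1, - w.2) = (nm w, 0).
Proof.
move=> w0; rewrite /rot /= mulNr opprK -!expr2 -nm_sq expr2 mulfK // .
by rewrite mulNr [w.2 * _]mulrC subrr mul0r.
Qed.

Lemma rot_comb w s p q : rot w (comb s p q) = comb s (rot w p) (rot w q).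
Proof. by rewrite /rot /comb /=; congr pair; ring. Qed.

(** Visibility keeps both angles below pi after the angle of [w] is added, so their order can still
    be read off the cosines. *)
Lemma extreme_rot v p w : 0 <= v.2 -> 0 <= p.2 -> 0 <= w.2 -> 0 < nm w ->
  extreme v p -> ~~ bent v w -> ~~ bent p w -> extreme (rot w v) (rot w p).
Proof.
move=> v2 p2 w2 wp; rewrite /extreme !nm_rot ?gt_eqF //= => e bv bp.
have cv := visible_cross v2 w2 bv; have cp := visible_cross p2 w2 bp.
have nv := nm_ge0 v; have np := nm_ge0 p.
rewrite mulrAC [leRHS]mulrAC ler_pM2r ?invr_gt0 // -subr_ge0.
set a1 := p.1 * nm v - v.1 * nm p.
have a10 : 0 <= a1 by rewrite subr_ge0.
pose S := v.2 * nm p + p.2 * nm v.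
have S0 : 0 <= S by rewrite addr_ge0 // mulr_ge0.
(* Up to scale, [a1] is a difference of cosines and [S] a sum of sines; both sides are differences
   of squares, equal by Pythagoras. This lets the sign be tested after multiplication by [S]. *)
have aS : a1 * (p.1 * nm v + v.1 * nm p) = (v.2 * nm p - p.2 * nm v) * S.
  have -> : a1 * (p.1 * nm v + v.1 * nm p) = p.1 ^+ 2 * nm v ^+ 2 - v.1 ^+ 2 * nm p ^+ 2.
    by rewrite /a1; ring.
  have -> : (v.2 * nm p - p.2 * nm v) * S = v.2 ^+ 2 * nm p ^+ 2 - p.2 ^+ 2 * nm v ^+ 2.
    by rewrite /S; ring.
  by rewrite !nm_sq; ring.
have -> : (p.1 * w.1 - p.2 * w.2) * nm v - (v.1 * w.1 - v.2 * w.2) * nm p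
  = a1 * w.1 + (v.2 * nm p - p.2 * nm v) * w.2 by rewrite /a1; ring.
case: (eqVneq S 0) => Sz; last first.
  have Sp : 0 < S by rewrite lt_def Sz.
  rewrite -(pmulr_lge0 _ Sp).
  have -> : (a1 * w.1 + (v.2 * nm p - p.2 * nm v) * w.2) * S =
    a1 * (nm p * (v.1 * w.2 + w.1 * v.2) + nm v * (p.1 * w.2 + w.1 * p.2)).
    transitivity (a1 * w.1 * S + (v.2 * nm p - p.2 * nm v) * S * w.2); first by ring.
    by rewrite -aS /S; ring.
  by rewrite mulr_ge0 // addr_ge0 // mulr_ge0.
have vz : v.2 * nm p = 0 by move: Sz; rewrite /S; have := mulr_ge0 v2 np; have := mulr_ge0 p2 nv; lra.
have pz : p.2 * nm v = 0 by move: Sz; rewrite /S vz add0r.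
rewrite vz pz subrr mul0r addr0.
case: (leP 0 w.1) => w1; first exact: mulr_ge0.
suff : a1 = 0 by move=> ->; rewrite mul0r.
move: bv bp; rewrite /bent -!ltNge => bv bp.
have vp : 0 < v.1.
  by case: (ltP 0 v.1) => // h; have := nm_ge0 w; nra.
have ppos : 0 < p.1.
  by case: (ltP 0 p.1) => // h; have := nm_ge0 w; nra.
have E : (p.1 * nm v) ^+ 2 = (v.1 * nm p) ^+ 2.
  by rewrite !exprMn; move: (f_equal (fun z => z ^+ 2) vz) (f_equal (fun z => z ^+ 2) pz);
   rewrite !exprMn expr0n !nm_sq /=; nra.
apply/eqP; rewrite subr_eq0; apply/eqP; apply: eqr_of_sqr E; exact: mulr_ge0 (ltW _) _.
Qed.

End Extreme.

(** * Majorization of CAT(0) polygons by convex ones *)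

Section Majorization.
Variable R : rcfType.
Implicit Types (N : nat) (x : nat -> R * R) (w : R * R).

(* A polygon [x 0, ..., x N] in standard position: its closing edge lies on the
   axis, and the polygon lies in the angles at the two ends of that edge. *)
Definition frame N x := [/\
  [/\ x 0%N = (0, 0), (x N).2 = 0 & 0 <= (x N).1],
  forall i, (i <= N)%N -> 0 <= (x i).2,
  forall i, (i <= N)%N -> extreme (x 1%N) (x i) &
  forall i, (i <= N)%N -> extreme (mir (x N).1 (x N.-1)) (mir (x N).1 (x i))].

Definition majorized (T : Type) (rho : T -> T -> R) N (p : nat -> T) :=
  exists x, [/\ frame N x,
    forall i, (i < N)%N -> dst (x i) (x i.+1) = rho (p i) (p i.+1),
    dst (x 0%N) (x N) = rho (p 0%N) (p N) &
    forall i j, (i <= N)%N -> (j <= N)%N -> rho (p i) (p j) <= dst (x i) (x j)].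

Lemma frame_last N x : frame N x -> x N = ((x N).1, 0).
Proof. by case=> [[_ <- _] _ _ _]; case: (x N). Qed.

Section Insert.
Variables (T : Type) (rho : T -> T -> R).
Hypothesis rhoP : CAT0 rho.

Let ratio (a b : R) : 0 <= a -> 0 <= b ->
  [/\ 0 <= a / (a + b) <= 1, a / (a + b) * (a + b) = a &
      (1 - a / (a + b)) * (a + b) = b].
Proof.
move=> a0 b0; case: (eqVneq (a + b) 0) => [s0|sn0].
  have -> : a = 0 by lra. have -> : b = 0 by lra.
  by rewrite addr0 mul0r lexx ler01 !mulr0.
have sp : 0 < a + b by rewrite lt_def sn0 addr_ge0.
by split; [rewrite divr_ge0 ?(ltW sp) // ler_pdivrMr // mul1r lerDl
  | rewrite divfK | rewrite mulrBl divfK // mul1r addrAC subrr add0r].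
Qed.

(** The closing edge of the polygon without [p 0] joins the two neighbours of [p 0]; the vertex is
    put back on that edge, and the CAT(0) inequality bounds its distances. *)
Lemma majorized_insert_first N (p : nat -> T) : (0 < N)%N ->
  rho (p 1%N) (p 0%N) + rho (p 0%N) (p N.+1) = rho (p 1%N) (p N.+1) ->
  majorized rho N (fun i => p i.+1) -> majorized rho N.+1 p.
Proof.
case: rhoP => -[r0 rge rC rtri] _ N0 btw [x [fx ex cx dx]].
have xN := frame_last fx.
have [[x0 _ l0] x2 e1 e2] := fx.
set a := rho (p 1%N) (p 0%N) in btw; set b := rho (p 0%N) (p N.+1) in btw.
have a0 : 0 <= a by exact: rge.
have b0 : 0 <= b by exact: rge.
have lE : (x N).1 = a + b.
  by move: cx; rewrite x0 xN dstC dst0 nm_axis // -btw.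
(* Sliding by [- a] brings the inserted vertex to the origin and [x 0] to [(- a, 0)]. *)
pose y i : R * R := if i is i'.+1 then ((x i').1 - a, (x i').2) else (0, 0).
have dy i j : dst (y i.+1) (y j.+1) = dst (x i) (x j).
  by rewrite /dst /y /=; congr nm; congr pair; ring.
have yN : y N.+1 = (b, 0) by rewrite /y xN /= lE; congr pair; ring.
have y1 : y 1%N = (- a, 0) by rewrite /y x0 /=; congr pair; ring.
exists y; split.
- split; first by rewrite yN.
  + by case=> [|i] //= iN; exact: x2.
  + by move=> i _; rewrite y1; exact: extreme_neg_axis.
  have yl : y N = ((x N.-1).1 - a, (x N.-1).2) by rewrite -{1}(prednK N0).
  have mE i : mir b ((x i).1 - a, (x i).2) = mir (x N).1 (x i).
    by rewrite /mir lE /=; congr pair; ring.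
  rewrite yN /= yl mE; case=> [_|i iN].
    by rewrite /mir /= subr0; exact: extreme_axis.
  by rewrite /y mE; exact: e2.
- case=> [_|i iN]; last by rewrite dy; exact: ex.
  by rewrite y1 dstC dst0 rC -/a -[RHS](nm_axis a0) /nm /= sqrrN.
- by rewrite yN dstC dst0 nm_axis.
have [s01 sa sb] := ratio a0 b0; have /andP[s0 s1] := s01.
have d0 j : (j <= N)%N -> rho (p j.+1) (p 0%N) <= dst (y j.+1) (y 0%N).
  move=> jN; apply: ler_of_sqr; first exact: dst_ge0.
  set s := a / (a + b) in s01 sa sb s0 s1.
  have h : cn_at rho (p 1%N) (p N.+1) s (p 0%N).
    by apply: cn_between => //; rewrite -btw.
  apply: le_trans (h _) _.
  have -> : dst (y j.+1) (y 0%N) = dst (x j) (comb s (x 0%N) (x N)).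
    have -> : comb s (x 0%N) (x N) = (a, 0).
      by rewrite x0 xN /comb /= lE sa; congr pair; ring.
    by rewrite /dst /y /=; congr nm; congr pair; ring.
  rewrite dst_comb_sq cx.
  have h1 : rho (p j.+1) (p 1%N) ^+ 2 <= dst (x j) (x 0%N) ^+ 2.
    by rewrite ler_sqr ?nnegrE ?rge ?dst_ge0 //; exact: dx.
  have h2 : rho (p j.+1) (p N.+1) ^+ 2 <= dst (x j) (x N) ^+ 2.
    by rewrite ler_sqr ?nnegrE ?rge ?dst_ge0 //; exact: dx.
  have s1' : 0 <= 1 - s by lra.
  by have := ler_wpM2l s1' h1; have := ler_wpM2l s0 h2; lra.
move=> [|i] [|j] iN jN.
- by rewrite r0 dst_ge0.
- by rewrite rC dstC; exact: d0.
- exact: d0.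
- by rewrite dy; exact: dx.
Qed.

(** Here the vertex returns on the last side rather than on the closing edge, so the other vertices
    stay in place. *)
Lemma majorized_insert_last N (p : nat -> T) :  (0 < N)%N ->
  rho (p N.-1) (p N) + rho (p N) (p N.+1) = rho (p N.-1) (p N.+1) ->
  majorized rho N (fun i => if (i < N)%N then p i else p i.+1) ->
  majorized rho N.+1 p.
Proof.
case: rhoP => -[r0 rge rC rtri] _ N0 btw [x [fx ex cx dx]].
have xN := frame_last fx.
have [[x0 _ l0] x2 e1 e2] := fx.
have N1 : (N.-1 < N)%N by rewrite prednK.
set a := rho (p N.-1) (p N) in btw; set b := rho (p N) (p N.+1) in btw.
have a0 : 0 <= a by exact: rge.
have b0 : 0 <= b by exact: rge.
have [s01 sa sb] := ratio a0 b0; have /andP[s0 s1] := s01.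
set s := a / (a + b) in s01 sa sb s0 s1.
have lE : dst (x N.-1) (x N) = a + b.
  by have := ex _ N1; rewrite N1 prednK // ltnn btw.
pose m := comb s (x N.-1) (x N).
have m2 : 0 <= m.2 by rewrite addr_ge0 // mulr_ge0 ?subr_ge0 ?x2 // ltnW.
pose y i := if (i < N)%N then x i else if i == N then m else x N.
have yl i : (i < N)%N -> y i = x i by rewrite /y => ->.
have yN : y N = m by rewrite /y ltnn eqxx.
have yS : y N.+1 = x N by rewrite /y ltnNge leqnSn /= gtn_eqF.
have cs i : (i <= N.+1)%N -> [\/ (i < N)%N, i = N | i = N.+1].
  rewrite leq_eqVlt => /predU1P[->|]; first by constructor 3.
  by rewrite ltnS leq_eqVlt => /predU1P[->|]; [constructor 2 | constructor 1].
have dm i : (i <= N)%N -> rho (if (i < N)%N then p i else p i.+1) (p N) <= dst (x i) m.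
  move=> iN; apply: ler_of_sqr; first exact: dst_ge0.
  have h : cn_at rho (p N.-1) (p N.+1) s (p N).
    by apply: cn_between => //; rewrite -btw.
  apply: le_trans (h _) _; rewrite dst_comb_sq lE -btw.
  have h1 : rho (if (i < N)%N then p i else p i.+1) (p N.-1) ^+ 2 <= dst (x i) (x N.-1) ^+ 2.
    rewrite ler_sqr ?nnegrE ?rge ?dst_ge0 //.
    by have := dx i N.-1 iN (ltnW N1); rewrite N1.
  have h2 : rho (if (i < N)%N then p i else p i.+1) (p N.+1) ^+ 2 <= dst (x i) (x N) ^+ 2.
    rewrite ler_sqr ?nnegrE ?rge ?dst_ge0 //.
    by have := dx i N iN (leqnn _); rewrite ltnn.
  have s1' : 0 <= 1 - s by lra.
  by have := ler_wpM2l s1' h1; have := ler_wpM2l s0 h2; lra.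
exists y; split.
- split; first by rewrite yS yl //; case: fx => [[]].
  + by move=> i /cs[iN|->|->]; rewrite ?yN ?yS ?yl //; apply: x2 => //; exact: ltnW.
  (* If [N = 1], the inserted vertex is itself the neighbour [y 1] of the origin, and it lies on the
     axis. *)
  + case: (ltnP 1 N) => N2.
      move=> i; rewrite (yl 1%N) // => /cs[iN|->|->].
      * by rewrite yl //; apply/e1/ltnW.
      * by rewrite yN; apply: extreme_comb; rewrite ?x2 ?e1 // ltnW.
      * by rewrite yS; apply: e1.
    have {}N2 : N = 1%N by apply/eqP; rewrite eqn_leq N2.
    have mE : m = (s * (x N).1, 0).
      by rewrite /m /comb N2 /= x0 -N2 xN /=; congr pair; ring.
    have -> : y 1%N = (s * (x N).1, 0) by rewrite -mE -yN N2.
    move=> i /cs[iN|->|->].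
    * have -> : i = 0%N by move: iN; rewrite N2 ltnS leqn0 => /eqP.
      by rewrite yl // x0; exact: extreme0.
    * by rewrite yN mE; exact: extreme_refl.
    * by rewrite yS xN /=; exact: extreme_axis.
  move=> i; rewrite yS /= yN => iN.
  have -> : mir (x N).1 m = ((1 - s) * (mir (x N).1 (x N.-1)).1, (1 - s) * (mir (x N).1 (x N.-1)).2).
    by rewrite /mir /m /comb xN /=; congr pair; ring.
  case: (cs _ iN) => [iN'|->|->].
  + by rewrite yl //; apply: extremeZl; [lra | apply/e2/ltnW].
  + have -> : mir (x N).1 (y N) = ((1 - s) * (mir (x N).1 (x N.-1)).1, (1 - s) * (mir (x N).1 (x N.-1)).2).
      by rewrite yN /mir /m /comb xN /=; congr pair; ring.
    exact: extreme_refl.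
  + have -> : mir (x N).1 (y N.+1) = (0, 0) by rewrite yS {2}xN /mir /= subrr.
    exact: extreme0.
- move=> i; rewrite ltnS leq_eqVlt => /predU1P[->|iN].
    by rewrite yN yS dst_combr // lE sb.
  rewrite yl //; case: (ltnP i.+1 N) => iN1.
    by have := ex i iN; rewrite yl // iN iN1.
  have iE : i.+1 = N by apply/eqP; rewrite eqn_leq iN.
  have -> : i = N.-1 by rewrite -iE.
  by rewrite prednK // yN dst_combl // lE sa.
- by rewrite yS yl // cx N0 ltnn.
move=> i j /cs[iN|->|->] /cs[jN|->|->]; rewrite ?yN ?yS ?yl //.
- by have := dx i j (ltnW iN) (ltnW jN); rewrite iN jN.
- by have := dm i (ltnW iN); rewrite iN.
- by have := dx i N (ltnW iN) (leqnn _); rewrite iN ltnn.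
- by have := dm j (ltnW jN); rewrite jN rC dstC.
- by rewrite r0 dst_ge0.
- by have := dm N (leqnn _); rewrite ltnn rC dstC.
- by have := dx N j (leqnn _) (ltnW jN); rewrite jN ltnn.
- by have := dm N (leqnn _); rewrite ltnn.
- by rewrite r0 dst_ge0.
Qed.

End Insert.

Definition ear N x w i : bool * (R * R) :=
  if (i <= N)%N then (true, x i) else (false, w).

(** If the two extreme neighbours see [w] through the slit, so does every vertex other than the ends
    of the slit. Slit distances to [w] are then planar, and a rotation brings the new closing edge,
    from the origin to [w], onto the axis. *)
Lemma majorized_ear_visible N x w : (0 < N)%N -> frame N x -> 0 <= w.2 ->
  ~~ bent (x 1%N) w ->
  ~~ bent (mir (x N).1 (x N.-1)) (mir (x N).1 w) ->
  majorized (slit (x N).1) N.+1 (ear N x w).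
Proof.
move=> N0 fx w2 b1 bN; have xN := frame_last fx.
have [[x0 _ l0] x2 e1 e2] := fx.
set l := (x N).1 in xN l0 e2 bN *.
have wp : 0 < nm w.
  rewrite lt_def nm_ge0 andbT; apply: contraNneq b1 => wz.
  by rewrite /bent wz (nm_eq0 wz) mulr0 mul0r addr0.
have wn0 : nm w != 0 by rewrite gt_eqF.
have vis i : (i <= N)%N -> [\/ x i = (0, 0), x i = (l, 0) |
    ~~ bent (x i) w /\ ~~ bent (mir l (x i)) (mir l w)].
  move=> iN; case: (eqVneq (nm (x i)) 0) => [/nm_eq0|n0]; first by constructor 1.
  case: (eqVneq (nm (mir l (x i))) 0) => [|n1].
    by rewrite nm_mir => /dst_eq0; constructor 2.
  constructor 3; split; first exact: extreme_visible (e1 _ iN) _ _.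
  exact: extreme_visible (e2 _ iN) _ _.
have oE i : (i <= N)%N -> opp l (x i) w = odst (x i) w.
  move=> /vis[->|->|[h1 h2]].
  - by rewrite odst_axis opp_axis // lexx.
  - by rewrite odst_axis opp_axis // lexx l0.
  - by rewrite /opp (negbTE h1) (negbTE h2).
have sE i j : (i <= N)%N -> (j <= N)%N ->
    slit l (true, x i) (true, x j) = dst (x i) (x j).
  by move=> iN jN; rewrite /slit /= !fold_id ?x2.
have sw i : (i <= N)%N -> slit l (true, x i) (false, w) = odst (x i) w.
  by move=> iN; rewrite /slit /= !fold_id ?x2 ?oE.
have odstE p : odst p w = dst (rot w p) (nm w, 0).
  by rewrite -(rot_conj wn0) dst_rot // /odst /dst /= opprK.
pose y i := if (i <= N)%N then rot w (x i) else (nm w, 0).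
have yl i : (i <= N)%N -> y i = rot w (x i) by rewrite /y => ->.
have yS : y N.+1 = (nm w, 0) by rewrite /y ltnn.
have el i : (i <= N)%N -> ear N x w i = (true, x i) by rewrite /ear => ->.
have eS : ear N x w N.+1 = (false, w) by rewrite /ear ltnn.
have cs i : (i <= N.+1)%N -> (i <= N)%N \/ i = N.+1.
  by rewrite leq_eqVlt => /predU1P[->|]; [right|left].
have rot2 i : (i <= N)%N -> 0 <= (rot w (x i)).2.
  move=> iN; rewrite /rot /= divr_ge0 ?nm_ge0 // [(x i).2 * _]mulrC.
  by have [->|->|[h _]] := vis i iN; rewrite /= ?mulr0 ?mul0r ?addr0 ?mulr_ge0 //;
    rewrite [w.1 * _]mulrC [(x i).2 * _]mulrC; apply: le_trans (visible_cross (x2 _ iN) w2 h) _; lra.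
exists y; split.
- have m0 : mir (nm w) (0, 0) = (nm w, 0) by rewrite /mir /= subr0.
  have mw : mir (nm w) (nm w, 0) = (0, 0) by rewrite /mir /= subrr.
  have mirC s p q : mir (nm w) (comb s p q) = comb s (mir (nm w) p) (mir (nm w) q).
    by rewrite /mir /comb /=; congr pair; ring.
  split.
  + by rewrite yS yl // x0 rot0 /= nm_ge0.
  + by move=> i /cs[iN|->]; rewrite ?yS // yl // rot2.
  + move=> i /cs[iN|->]; rewrite (yl 1%N) // ?yS; last exact: extreme_axis (nm_ge0 _).
    rewrite yl //; case: (eqVneq (nm (x i)) 0) => [/nm_eq0->|n0].
      by rewrite rot0; exact: extreme0.
    apply: extreme_rot => //; [exact: x2 | exact: x2 | exact: e1 |].
    exact: extreme_visible (e1 _ iN) _ _.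
  rewrite yS /= yl // => i /cs[iN|->]; last by rewrite yS mw; exact: extreme0.
  rewrite yl //; have [->|->|[h1 h2]] := vis i iN.
  * by rewrite rot0 m0; exact: extreme_axis (nm_ge0 _).
  * by rewrite xN; exact: extreme_refl.
  have [z /andP[z0 zl] [_]] := opp_attained l0 (x2 _ iN) w2.
  case=> [[b _]|[b _]|[_ [t /andP[t0 t1] [zE d1 d2]]]]; [by rewrite b in h1 | by rewrite b in h2|].
  have {zE} zE : rot w (z, 0) = comb t (rot w (x i)) (nm w, 0).
    by rewrite zE rot_comb rot_conj.
  (* The angle at [w] contains the slit, hence [(z, 0)], and with it the point [x i] on the ray from
     [w] through [(z, 0)]. *)
  have ez : extreme (mir (nm w) (rot w (x N))) (mir (nm w) (rot w (z, 0))).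
    case: (eqVneq l 0) => ln0.
      have -> : z = 0 by lra.
      by rewrite rot0 m0; exact: extreme_axis (nm_ge0 _).
    have -> : (z, 0) = comb (z / l) (0, 0) (x N).
      by rewrite xN /comb /= divfK //; congr pair; ring.
    rewrite rot_comb mirC rot0 m0; apply: extreme_comb => //.
    * by rewrite divr_ge0 // ler_pdivrMr ?mul1r // lt_def ln0.
    * exact: rot2.
    * exact: extreme_axis (nm_ge0 _).
    * exact: extreme_refl.
  (* At [t = 1] there is no such ray: [w] lies on the slit, the rotation is trivial, and [x N] is at
     [w] or beyond it on the axis. *)
  have := t1; rewrite le_eqVlt => /predU1P[t1E|tl]; last first.
    apply: (@extremeZr _ (1 - t)); first by lra.
    move: ez; rewrite zE mirC mw; congr (is_true (extreme _ _)).
    by rewrite /comb /=; congr pair; ring.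
  have wE : w = (z, 0).
    move: d2; rewrite t1E subrr mul0r => /dst_eq0; exact.
  have xE : rot w (x N) = (l, 0).
    rewrite /rot xN wE /= nm_axis // !mulr0 !mul0r subr0 addr0 mul0r mulfK //.
    by rewrite wE nm_axis // in wn0.
  rewrite xE /mir /= wE nm_axis // -opprB; apply: extreme_neg_axis; lra.
- move=> i; rewrite ltnS leq_eqVlt => /predU1P[->|iN].
    by rewrite el // eS sw // yl // yS odstE.
  by rewrite !el ?(ltnW iN) // sE ?(ltnW iN) // !yl ?(ltnW iN) // dst_rot.
- by rewrite el // eS sw // yl // yS odstE.
move=> i j /cs[iN|->] /cs[jN|->]; rewrite ?eS ?el // ?yS ?yl //.
- by rewrite sE // dst_rot.
- by rewrite sw // odstE.
- by rewrite slitC sw // odstE dstC.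
- by rewrite /slit /= !dstxx.
Qed.

(** The hypothesis ranges over all CAT(0) spaces because it is applied in the slit plane itself, to
    the [N.+1] points left when an end of the slit is dropped. *)
Lemma majorized_ear N x w : (0 < N)%N -> frame N x -> 0 <= w.2 ->
  (forall (T : Type) (rho : T -> T -> R) p, CAT0 rho -> majorized rho N p) ->
  majorized (slit (x N).1) N.+1 (ear N x w).
Proof.
move=> N0 fx w2 IH; have xN := frame_last fx.
have [[x0 _ l0] x2 e1 e2] := fx.
have sC := slit_CAT0 l0.
have fw : fold w = w by rewrite fold_id.
have fi i : (i <= N)%N -> fold (x i) = x i by move=> iN; rewrite fold_id ?x2.
have el i : (i <= N)%N -> ear N x w i = (true, x i) by rewrite /ear => ->.
have eS : ear N x w N.+1 = (false, w) by rewrite /ear ltnn.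
have N1 : (N.-1 <= N)%N by exact: leq_pred.
have l01 : 0 <= (x N).1 <= (x N).1 by rewrite l0 lexx.
case: (boolP (bent (x 1%N) w)) => b1.
  apply: majorized_insert_first => //; last exact: IH.
  rewrite eS !el // /slit /= !fi // fw x0 dst0 (opp_bent _ b1) opp_axis ?lexx //.
  by rewrite (dstC (0, 0)) dst0.
case: (boolP (bent (mir (x N).1 (x N.-1)) (mir (x N).1 w))) => bN; last first.
  exact: majorized_ear_visible.
apply: majorized_insert_last => //; last exact: IH.
rewrite eS !el // /slit /= !fi // fw (opp_bent_mir l0 bN) !nm_mir.
have oE : opp (x N).1 (x N) w = dst (x N) w by rewrite {2 3}xN opp_axis.
by rewrite oE -xN [dst w _]dstC.
Qed.

(** The induction glues the comparison triangle of [p 0], [p N.+1], [p N.+2] below the closing edge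
    of a majorizing polygon; [majorized_ear] makes the result convex. *)
Theorem CAT0_majorized N (T : Type) (rho : T -> T -> R) p :
  (0 < N)%N -> CAT0 rho -> majorized rho N p.
Proof.
elim: N T rho p => // -[_|N IH] T rho p _ rhoP; have [[r0 rge rC rtri] geo] := rhoP.
  pose x i : R * R := if i == 0%N then (0, 0) else (rho (p 0%N) (p 1%N), 0).
  have d01 : dst (x 0%N) (x 1%N) = rho (p 0%N) (p 1%N).
    by rewrite dstC /x /= dst0 nm_axis.
  exists x; split=> //; [split=> //= | by case |].
  + by move=> [|[|i]].
  + move=> [|[|i]] // _; [exact: extreme0 | exact: extreme_refl].
  + move=> [|[|i]] // _; [exact: extreme_refl|].
    by rewrite /mir /x /= subrr; exact: extreme0.
  + move=> [|[|i]] [|[|j]] // _ _; rewrite ?r0 ?dst_ge0 ?d01 //.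
    by rewrite rC dstC d01.
have [x [fx ex cx dx]] := IH T rho p isT rhoP.
have xN := frame_last fx.
have [[x0 _ l0] x2 e1 e2] := fx.
have lE : (x N.+1).1 = rho (p 0%N) (p N.+1).
  by rewrite -cx x0 dstC dst0 xN nm_axis.
have [w [w2 wb wc]] : exists w, [/\ 0 <= w.2, nm w = rho (p 0%N) (p N.+2) &
    dst (x N.+1) w = rho (p N.+1) (p N.+2)].
  have h1 := rtri (p 0%N) (p N.+1) (p N.+2).
  have h2 := rtri (p 0%N) (p N.+2) (p N.+1).
  have h3 := rtri (p N.+1) (p N.+2) (p 0%N).
  rewrite (rC (p N.+2) (p N.+1)) in h1; rewrite (rC (p N.+1) (p 0%N)) in h3.
  by rewrite xN lE; apply: triangle_exists.
have [y [fy ey cy dy]] := majorized_ear (isT : (0 < N.+1)%N) fx w2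
   (fun T rho p => IH T rho p isT).
set l := (x N.+1).1 in l0 lE ey cy dy *.
have fw : fold w = w by rewrite fold_id.
have fi i : (i <= N.+1)%N -> fold (x i) = x i by move=> iN; rewrite fold_id ?x2.
have el i : (i <= N.+1)%N -> ear N.+1 x w i = (true, x i) by rewrite /ear => ->.
have eS : ear N.+1 x w N.+2 = (false, w) by rewrite /ear ltnn.
exists y; split=> //.
- move=> i; rewrite ltnS => iN; rewrite ey //; move: iN.
  rewrite leq_eqVlt => /predU1P[->|iN].
    rewrite eS el // /slit /= fi // fw xN opp_axis ?lexx ?l0 // -xN; exact: wc.
  by rewrite !el ?(ltnW iN) // /slit /= !fi ?(ltnW iN) // ex.
- by rewrite cy eS el // /slit /= fi // fw x0 opp_axis ?lexx // dstC dst0.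
(* The crossing point of the slit corresponds to the point [m] at the same ratio between [p 0] and
   [p N.+1]; the CAT(0) inequality at [m] bounds both parts of the path. *)
have dw i : (i <= N.+1)%N -> rho (p i) (p N.+2) <= slit l (true, x i) (false, w).
  move=> iN; rewrite /slit /= fi // fw.
  have [z /andP[z0 zl] [-> _]] := opp_attained l0 (x2 _ iN) w2.
  have [s [s01 zE]] : exists s, 0 <= s <= 1 /\ (z, 0) = comb s (x 0%N) (x N.+1).
    case: (eqVneq l 0) => ln0.
      exists 0; rewrite lexx ler01; split => //.
      have -> : z = 0 by lra.
      by rewrite x0 /comb /=; congr pair; ring.
    exists (z / l); split.
      by rewrite divr_ge0 // ler_pdivrMr ?mul1r // lt_def ln0.
    by rewrite x0 xN /comb /= divfK //; congr pair; ring.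
  have /andP[s0 s1] := s01; have s1' : 0 <= 1 - s by lra.
  have [m mP] := geo (p 0%N) (p N.+1) s s01.
  have cmp q (u : R * R) : rho q (p 0%N) <= dst u (x 0%N) ->
      rho q (p N.+1) <= dst u (x N.+1) -> rho q m <= dst u (z, 0).
    move=> h0 h1; apply: ler_of_sqr; first exact: dst_ge0.
    apply: le_trans (mP _) _; rewrite zE dst_comb_sq cx.
    have {}h0 : rho q (p 0%N) ^+ 2 <= dst u (x 0%N) ^+ 2.
      by rewrite ler_sqr ?nnegrE ?rge ?dst_ge0.
    have {}h1 : rho q (p N.+1) ^+ 2 <= dst u (x N.+1) ^+ 2.
      by rewrite ler_sqr ?nnegrE ?rge ?dst_ge0.
    by have := ler_wpM2l s1' h0; have := ler_wpM2l s0 h1; lra.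
  have m1 : rho (p i) m <= dst (x i) (z, 0) by apply: cmp; exact: dx.
  have m2 : rho (p N.+2) m <= dst w (z, 0).
    by apply: cmp; rewrite ?x0 ?dst0 ?wb 1?dstC ?wc 1?rC.
  by have := rtri (p i) (p N.+2) m; rewrite (rC m); lra.
have cs i : (i <= N.+2)%N -> (i <= N.+1)%N \/ i = N.+2.
  by rewrite leq_eqVlt => /predU1P[->|]; [right|left].
move=> i j hi hj; apply: le_trans (dy i j hi hj).
move: hi hj => /cs[iN|->] /cs[jN|->]; rewrite ?eS ?el //.
- by rewrite /slit /= !fi //; exact: dx.
- exact: dw.
- by rewrite rC slitC; exact: dw.
- by rewrite r0 /slit /= dst_ge0.
Qed.

End Majorization.

(** * Rough fans *)

Section RoughFan.
Variables (R : rcfType) (T : Type) (rho : T -> T -> R).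
Hypothesis rhoP : pseudometric rho.
Variables (C : R) (N : nat) (y : nat -> T) (z : nat -> R -> T).
Hypothesis C0 : 0 <= C.
Hypothesis z_base : forall k s, (0 < k <= N)%N -> 0 <= s <= 1 ->
  rho (y 0%N) (z k s) <= s * rho (y 0%N) (y k).
Hypothesis z1 : forall k, z k 1 = y k.
Hypothesis z_comparison : forall k s t (u v : R * R), (0 < k < N)%N ->
  0 <= s <= 1 -> 0 <= t <= 1 ->
  nm u = rho (y 0%N) (y k) -> nm v = rho (y 0%N) (y k.+1) ->
  dst u v = rho (y k) (y k.+1) ->
  rho (z k s) (z k.+1 t) <= dst (s * u.1, s * u.2) (t * v.1, t * v.2) + C.

(** [z k s] stands for a point at ratio [s] on the radius from [y 0] to [y k]. The last clause
    serves the induction: the next triangle is glued along that radius. The [n.+2] points span [n]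
    triangles, each costing [C]. *)
Lemma rough_fan_majorized n : (n < N)%N -> exists x : nat -> R * R,
  [/\ frame n.+1 x,
    forall i, (i < n.+1)%N -> dst (x i) (x i.+1) = rho (y i) (y i.+1) /\
       rho (y 0%N) (y i.+1) <= dst (x 0%N) (x i.+1),
    dst (x 0%N) (x n.+1) = rho (y 0%N) (y n.+1),
    forall i j, (i <= n.+1)%N -> (j <= n.+1)%N ->
      rho (y i) (y j) <= dst (x i) (x j) + n%:R * C &
    forall i t, (i < n.+1)%N -> 0 <= t <= 1 ->
      rho (y i) (z n.+1 t) <= dst (x i) (t * (x n.+1).1, t * (x n.+1).2) + n%:R * C].
Proof.
have [r0 rge rC rtri] := rhoP.
elim: n => [|n IH] nN.
  pose x i : R * R := if i == 0%N then (0, 0) else (rho (y 0%N) (y 1%N), 0).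
  have d01 : dst (x 0%N) (x 1%N) = rho (y 0%N) (y 1%N).
    by rewrite dstC /x /= dst0 nm_axis.
  exists x; split=> //; [split=> //= | by case=> // _; rewrite d01 | |].
  + by move=> [|[|i]].
  + move=> [|[|i]] // _; [exact: extreme0 | exact: extreme_refl].
  + move=> [|[|i]] // _; [exact: extreme_refl|].
    by rewrite /mir /x /= subrr; exact: extreme0.
  + move=> [|[|i]] [|[|j]] // _ _; rewrite mul0r addr0 ?r0 ?dst_ge0 ?d01 //.
    by rewrite rC dstC d01.
  move=> [|i] t // _ t01; have /andP[t0 t1] := t01.
  rewrite mul0r addr0 /x /= mulr0 dstC dst0 nm_axis ?mulr_ge0 //.
  exact: z_base.
have [x [fx ex cx dx zx]] := IH (ltnW nN).
have xN := frame_last fx.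
have [[x0 _ l0] x2 e1 e2] := fx.
have lE : (x n.+1).1 = rho (y 0%N) (y n.+1).
  by rewrite -cx x0 dstC dst0 xN nm_axis.
have [w [w2 wb wc]] : exists w, [/\ 0 <= w.2, nm w = rho (y 0%N) (y n.+2) &
    dst (x n.+1) w = rho (y n.+1) (y n.+2)].
  have h1 := rtri (y 0%N) (y n.+1) (y n.+2).
  have h2 := rtri (y 0%N) (y n.+2) (y n.+1).
  have h3 := rtri (y n.+1) (y n.+2) (y 0%N).
  rewrite (rC (y n.+2) (y n.+1)) in h1; rewrite (rC (y n.+1) (y 0%N)) in h3.
  by rewrite xN lE; apply: triangle_exists.
have [v [fv ev cv dv]] := majorized_ear (isT : (0 < n.+1)%N) fx w2
   (fun T rho p => @CAT0_majorized _ n.+1 T rho p isT).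
set l := (x n.+1).1 in l0 lE ev cv dv *.
have fw : fold w = w by rewrite fold_id.
have fi i : (i <= n.+1)%N -> fold (x i) = x i by move=> iN; rewrite fold_id ?x2.
have el i : (i <= n.+1)%N -> ear n.+1 x w i = (true, x i) by rewrite /ear => ->.
have eS : ear n.+1 x w n.+2 = (false, w) by rewrite /ear ltnn.
have l0l : 0 <= (0 : R) <= l by rewrite lexx.
have cv' : dst (v 0%N) (v n.+2) = nm w.
  by rewrite cv eS el // /slit /= fi // fw x0 opp_axis // dstC dst0.
have le_nC : n%:R * C <= n.+1%:R * C by rewrite ler_wpM2r // ler_nat.
have nC : n.+1%:R * C = n%:R * C + C by rewrite -natr1 mulrDl mul1r.
(* A path through the slit is followed by a rough path through the radius
   [z n.+1]. *)
have ow i t : (i <= n.+1)%N -> 0 <= t <= 1 ->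
    rho (y i) (z n.+2 t) <= opp l (x i) (t * w.1, t * w.2) + n.+1%:R * C.
  move=> iN t01; have /andP[t0 t1] := t01.
  have cmp s : 0 <= s <= 1 -> rho (z n.+1 s) (z n.+2 t) <=
      dst (s * l, 0) (t * w.1, t * w.2) + C.
    move=> s01.
    have -> : (s * l, 0) = (s * (x n.+1).1, s * (x n.+1).2).
      by rewrite [in RHS]xN /= mulr0.
    apply: z_comparison => //.
    by rewrite -lE xN nm_axis.
  (* The end [y n.+1] of the radius is not covered by [zx]; being [z n.+1 1], it falls under
     [z_comparison] directly. *)
  move: iN; rewrite leq_eqVlt => /predU1P[->|iN].
    have := cmp 1; rewrite ler01 lexx z1 mul1r => /(_ isT) h.
    have -> : opp l (x n.+1) (t * w.1, t * w.2) = dst (l, 0) (t * w.1, t * w.2).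
      by rewrite xN opp_axis // l0 lexx.
    by apply: le_trans h _; rewrite nC lerD2l lerDr mulr_ge0.
  have t2 : 0 <= (t * w.1, t * w.2).2 by exact: mulr_ge0.
  have [a /andP[a0 al] [-> _]] := opp_attained l0 (x2 _ (ltnW iN)) t2.
  have [s [s01 aE]] : exists s, 0 <= s <= 1 /\ a = s * l.
    case: (eqVneq l 0) => ln0.
      by exists 0; rewrite lexx ler01 mul0r; split => //; lra.
    exists (a / l); rewrite divfK //; split=> //.
    by rewrite divr_ge0 // ler_pdivrMr ?mul1r // lt_def ln0.
  have := zx i s iN s01; rewrite {2}xN /= mulr0 -/l -aE => h1.
  have := cmp s s01; rewrite -aE [dst (a, 0) _]dstC => h2.
  by have := rtri (y i) (z n.+2 t) (z n.+1 s); rewrite nC; lra.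
have ow1 i : (i <= n.+1)%N -> rho (y i) (y n.+2) <= dst (v i) (v n.+2) + n.+1%:R * C.
  move=> iN; have := ow i 1 iN; rewrite ler01 lexx z1 !mul1r => /(_ isT) /le_trans; apply.
  rewrite lerD2r; have := dv i n.+2 (leqW iN) (leqnn _).
  by rewrite el // eS /slit /= fi // fw; case: (w).
exists v; split=> //.
- move=> i iN; split.
    rewrite ev //; move: iN; rewrite ltnS leq_eqVlt => /predU1P[->|iN].
      rewrite eS el // /slit /= fi // fw xN opp_axis ?lexx ?l0 // -xN; exact: wc.
    rewrite !el ?(ltnW iN) // /slit /= !fi ?(ltnW iN) //; exact: (ex _ _).1.
  move: iN; rewrite ltnS leq_eqVlt => /predU1P[->|iN]; first by rewrite cv' wb.
  have := dv 0%N i.+1 isT (leqW iN); rewrite !el // /slit /= !fi //.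
  by apply: le_trans; exact: (ex _ _).2.
- by rewrite cv' wb.
- have cs i : (i <= n.+2)%N -> (i <= n.+1)%N \/ i = n.+2.
    by rewrite leq_eqVlt => /predU1P[->|]; [right|left].
  move=> i j hi hj; case: (cs i hi) (cs j hj) => [iN|->] [jN|->].
  + have := dv i j hi hj; rewrite !el // /slit /= !fi //.
    by have := dx i j iN jN; lra.
  + exact: ow1.
  + by rewrite rC dstC; exact: ow1.
  + by rewrite r0 addr_ge0 ?dst_ge0 // mulr_ge0.
move=> i t iN t01; apply: le_trans (ow i t iN t01) _; rewrite lerD2r.
(* Along the edge from the origin to [w], [opp_convex] bounds the squared slit distance by an
   interpolation that is exact for [v]; [dv] compares the end values. *)
apply: ler_of_sqr; first exact: dst_ge0.
have -> : (t * (v n.+2).1, t * (v n.+2).2) = comb t (v 0%N) (v n.+2).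
  by case: fv => [[-> _ _] _ _ _]; rewrite /comb /=; congr pair; ring.
have -> : (t * w.1, t * w.2) = comb t (x 0%N) w.
  by rewrite x0 /comb /=; congr pair; ring.
rewrite oppC; apply: le_trans (opp_convex l0 t01 _ _ _) _; rewrite ?x2 ?(ltnW iN) //.
rewrite dst_comb_sq cv' x0 (dstC (0, 0)) dst0 opp_axis // (dstC (0, 0)) dst0.
have /andP[t0 t1] := t01; have t1' : 0 <= 1 - t by lra.
have h1 : nm (x i) ^+ 2 <= dst (v i) (v 0%N) ^+ 2.
  rewrite ler_sqr ?nnegrE ?nm_ge0 ?dst_ge0 //.
  by have := dv i 0%N (ltnW iN) isT; rewrite !el // /slit /= !fi // x0 dst0.
have h2 : opp l w (x i) ^+ 2 <= dst (v i) (v n.+2) ^+ 2.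
  rewrite ler_sqr ?nnegrE ?opp_ge0 ?dst_ge0 // oppC.
  by have := dv i n.+2 (ltnW iN) (leqnn _); rewrite el // eS /slit /= fi // fw.
by have := ler_wpM2l t1' h1; have := ler_wpM2l t0 h2; lra.
Qed.

End RoughFan.

(** * The five-point estimate *)

Section FivePoint.
Variable R : rcfType.
Implicit Types (x y z u v : R * R) (s t a b c h : R).

(** With [e] and [f] the excesses of [A] and [B] over the two parts of [a], Stewart's identity
    leaves [2 * s * (1 - s) * a * (e + f)] plus a weighted mean of [e ^+ 2] and [f ^+ 2], where
    [a * (e + f) <= 1]. *)
Lemma lens_bound x y u s a h A B :
  0 <= s <= 1 -> 0 <= a -> 0 <= h <= 1 -> h * a <= 1 -> a <= dst x y ->
  dst x u <= A -> dst u y <= B -> s * a <= A -> (1 - s) * a <= B ->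
  A + B <= a + h -> dst u (comb s x y) <= 107 / 100.
Proof.
move=> /andP[s0 s1] a0 /andP[h0 h1] ha axy uA uB sA sB AB.
apply: ler_of_sqr; first lra.
rewrite dst_comb_sq (dstC u x).
have s1' : 0 <= 1 - s by lra.
have hA : dst x u ^+ 2 <= A ^+ 2 by rewrite ler_sqr ?nnegrE ?dst_ge0 //; apply: le_trans uA; exact: dst_ge0.
have hB : dst u y ^+ 2 <= B ^+ 2 by rewrite ler_sqr ?nnegrE ?dst_ge0 //; apply: le_trans uB; exact: dst_ge0.
have hxy : a ^+ 2 <= dst x y ^+ 2 by rewrite ler_sqr ?nnegrE ?dst_ge0.
have ss : 0 <= s * (1 - s) by exact: mulr_ge0.
have := ler_wpM2l s1' hA; have := ler_wpM2l s0 hB; have := ler_wpM2l ss hxy.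
move: (dst x u) (dst u y) (dst x y) => d1 d2 d3 i1 i2 i3.
pose e := A - s * a; pose f := B - (1 - s) * a.
have AE : A = s * a + e by rewrite /e; ring.
have BE : B = (1 - s) * a + f by rewrite /f; ring.
have e0 : 0 <= e by rewrite subr_ge0.
have f0 : 0 <= f by rewrite subr_ge0.
have ef : e + f <= h by rewrite /e /f; lra.
clearbody e f.
have E : (1 - s) * A ^+ 2 + s * B ^+ 2 - s * (1 - s) * a ^+ 2 =
  2 * (s * (1 - s)) * (a * (e + f)) + (1 - s) * e ^+ 2 + s * f ^+ 2.
  by rewrite AE BE; ring.
have aef : a * (e + f) <= 1 by apply: le_trans (_ : a * h <= _); [exact: ler_wpM2l | lra].
have j1 : s * (1 - s) * (a * (e + f)) <= s * (1 - s) by rewrite ler_piMr.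
have j2 : (1 - s) * e ^+ 2 + s * f ^+ 2 <= Num.max s (1 - s).
  have ef2 : e ^+ 2 + f ^+ 2 <= 1 by nra.
  case: (leP s (1 - s)) => hs.
    by have := ler_wpM2l s1' ef2; have := ler_wpM2r (sqr_ge0 f) hs; lra.
  by have := ler_wpM2l s0 ef2; have := ler_wpM2r (sqr_ge0 e) (ltW hs); lra.
(* The maximum is reached at [s = 1 / 4] and [s = 3 / 4]; [107 / 100] is just above the square root
   of [9 / 8]. *)
have j3 : 2 * (s * (1 - s)) + Num.max s (1 - s) <= 9 / 8.
  case: (leP s (1 - s)) => hs.
    by have := sqr_ge0 (s - 1 / 4); lra.
  by have := sqr_ge0 (s - 3 / 4); lra.
have : (107 / 100 : R) ^+ 2 >= 9 / 8 by lra.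
lra.
Qed.

Lemma comb_spread_sq x y z s t :
  dst (comb s x y) (comb t x z) ^+ 2 =
  s * (s - t) * dst x y ^+ 2 - t * (s - t) * dst x z ^+ 2 + s * t * dst y z ^+ 2.
Proof. by rewrite !dst_sq /=; ring. Qed.

(** The left side is the most that [comb_spread_sq] can grow when [a] becomes at most [a + h] and
    [b] does not shrink; the right side is [(D + 13 / 10) ^+ 2 - D ^+ 2]. *)
Lemma spread_ineq a b h s t D : 0 <= a -> 0 <= b -> 0 <= h <= 1 ->
  h * a <= 1 -> h * b <= 1 -> 0 <= t -> t <= s -> s <= 1 -> 0 <= D ->
  s * a - t * b <= D ->
  s * (s - t) * (2 * a * h + h ^+ 2) <= (13 / 10) ^+ 2 + 2 * (13 / 10) * D.
Proof.
move=> a0 b0 /andP[h0 h1] ha hb t0 ts s1 D0 hD.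
have s0 : 0 <= s by lra.
have st0 : 0 <= s - t by lra.
have sst : 0 <= s * (s - t) by exact: mulr_ge0.
have sst1 : s * (s - t) <= 1 by nra.
have q1 : s * (s - t) * h ^+ 2 <= 1.
  by have : h ^+ 2 <= 1 by [nra]; nra.
have tst : t * (s - t) <= 1 / 4.
  by have := sqr_ge0 (t - s / 2); nra.
have tst0 : 0 <= t * (s - t) by exact: mulr_ge0.
case: (leP b a) => ba.
  have : (s - t) * a <= D by have := ler_wpM2l t0 ba; lra.
  have : s * (s - t) * (a * h) <= (s - t) * a.
    have sh : s * h <= 1 by nra.
    have p0 : 0 <= (s - t) * a by exact: mulr_ge0.
    by have := ler_wpM2l p0 sh; lra.
  lra.
case: (ltP (s * a) (t * b)) => sab.
  have k0 : 0 <= h * (s - t) by exact: mulr_ge0.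
  have := ler_wpM2l k0 (ltW sab).
  have := ler_wpM2l tst0 hb; lra.
have k1 : s * (s - t) * (a * h) = h * s * (s * a - t * b) + h * s * t * (b - a) by ring.
have hs1 : h * s <= 1 by nra.
have sab' : 0 <= s * a - t * b by lra.
have k2 : h * s * (s * a - t * b) <= D by have := ler_wpM2r sab' hs1; lra.
have k3 : h * s * t * (b - a) <= 1 / 4.
  have k0 : 0 <= h * t by exact: mulr_ge0.
  have := ler_wpM2l k0 sab; have := ler_wpM2l tst0 hb; lra.
lra.
Qed.

(** By symmetry [t <= s]; then the square of [dst x z] has a nonpositive coefficient in
    [comb_spread_sq], and only the lengthening of [dst x y] counts. *)
Lemma spread_bound x y z x' y' z' s t h :
  0 <= h <= 1 -> h * dst x y <= 1 -> h * dst x z <= 1 ->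
  dst x y <= dst x' y' <= dst x y + h -> dst x z <= dst x' z' <= dst x z + h ->
  dst y' z' = dst y z -> 0 <= s <= 1 -> 0 <= t <= 1 ->
  dst (comb s x' y') (comb t x' z') <= dst (comb s x y) (comb t x z) + 13 / 10.
Proof.
wlog ts : s t y z y' z' / t <= s.
  move=> wl h01 hy hz hy' hz' yz s01 t01; case: (leP t s) => [ts|/ltW ts].
    exact: (wl s t y z y' z').
  rewrite [X in X <= _]dstC [X in _ <= X + _]dstC; apply: (wl t s z y z' y') => //.
  by rewrite dstC yz dstC.
move=> h01 hy hz /andP[y1 y2] /andP[z1 z2] yz /andP[s0 s1] /andP[t0 t1].
set D := dst (comb s x y) (comb t x z).
have D0 : 0 <= D by exact: dst_ge0.
apply: ler_of_sqr; first by lra.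
have hD : s * dst x y - t * dst x z <= D.
  have := dst_tri x (comb s x y) (comb t x z).
  by rewrite !dst_combl // (dstC (comb t x z)) -/D; lra.
have := spread_ineq (dst_ge0 x y) (dst_ge0 x z) h01 hy hz t0 ts s1 D0 hD.
have D2 : D ^+ 2 = s * (s - t) * dst x y ^+ 2 - t * (s - t) * dst x z ^+ 2 + s * t * dst y z ^+ 2.
  exact: comb_spread_sq.
rewrite comb_spread_sq yz.
have st0 : 0 <= s - t by lra.
have p1 : 0 <= s * (s - t) by exact: mulr_ge0.
have p2 : 0 <= t * (s - t) by exact: mulr_ge0.
have q1 : dst x' y' ^+ 2 <= (dst x y + h) ^+ 2.
  rewrite ler_sqr ?nnegrE ?dst_ge0 //; apply: le_trans y2; exact: dst_ge0.
have q2 : dst x z ^+ 2 <= dst x' z' ^+ 2 by rewrite ler_sqr ?nnegrE ?dst_ge0.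
have := ler_wpM2l p1 q1; have := ler_wpM2l p2 q2; lra.
Qed.

Lemma five_point_estimate x y z x' y' z' u' v' s t h Au Bu Av Bv :
  0 <= h <= 1 -> h * dst x y <= 1 -> h * dst x z <= 1 ->
  dst x y <= dst x' y' -> dst x z <= dst x' z' -> dst y' z' = dst y z ->
  0 <= s <= 1 -> 0 <= t <= 1 ->
  dst x' u' <= Au -> dst u' y' <= Bu -> s * dst x y <= Au ->
  (1 - s) * dst x y <= Bu -> Au + Bu <= dst x y + h ->
  dst x' v' <= Av -> dst v' z' <= Bv -> t * dst x z <= Av ->
  (1 - t) * dst x z <= Bv -> Av + Bv <= dst x z + h ->
  dst u' v' <= dst (comb s x y) (comb t x z) + 2 * Num.sqrt 3.
Proof.
move=> h01 hy hz yy zz yz s01 t01 u1 u2 u3 u4 u5 v1 v2 v3 v4 v5.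
have bu := lens_bound s01 (dst_ge0 x y) h01 hy yy u1 u2 u3 u4 u5.
have bv := lens_bound t01 (dst_ge0 x z) h01 hz zz v1 v2 v3 v4 v5.
have : dst (comb s x' y') (comb t x' z') <= dst (comb s x y) (comb t x z) + 13 / 10.
  apply: (@spread_bound _ _ _ _ _ _ _ _ h) => //; apply/andP; split=> //.
    by have := dst_tri x' y' u'; lra.
  by have := dst_tri x' z' v'; lra.
(* The two lenses and the spread cost [2 * (107 / 100) + 13 / 10] in all, which is twice
   [172 / 100]. *)
have : 172 / 100 <= Num.sqrt (3 : R).
  apply: ler_of_sqr; first exact: sqrtr_ge0.
  by rewrite sqr_sqrtr; lra.
have := dst_tri u' v' (comb s x' y').
have := dst_tri (comb s x' y') v' (comb t x' z').
by rewrite (dstC (comb t x' z')); lra.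
Qed.

End FivePoint.

(** * Paths and short segments *)

Section Coordinates.
Local Open Scope classical_set_scope.
Variable R : realType.
Implicit Types p q : 'rV[R]_2.

Definition coords p : R * R := (p 0 0, p 0 1).
Definition of_coords (a : R * R) : 'rV[R]_2 := \row_k (if k == 0 then a.1 else a.2).

Lemma of_coordsK a : coords (of_coords a) = a.
Proof. by case: a => a b; rewrite /coords /of_coords !mxE eqxx oner_eq0. Qed.

Lemma eucl_distE p q : eucl_dist p q = dst (coords p) (coords q).
Proof.
rewrite /eucl_dist /dst /nm big_ord_recl big_ord1.
by rewrite (_ : lift ord0 ord0 = 1) //; exact: val_inj.
Qed.

Lemma coords_comb s p q : coords ((1 - s) *: p + s *: q) = comb s (coords p) (coords q).
Proof. by rewrite /coords /comb !mxE. Qed.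

Lemma eucl_segmentP p q u : eucl_segment p q u ->
  exists2 s, 0 <= s <= 1 & coords u = comb s (coords p) (coords q).
Proof. by move=> [s]; rewrite /= in_itv /= => s01 <-; exists s; rewrite ?coords_comb. Qed.

Lemma eucl_segment_comb s p q u : 0 <= s <= 1 ->
  coords u = comb s (coords p) (coords q) -> eucl_segment p q u.
Proof.
move=> s01; rewrite -coords_comb => E; exists s; first by rewrite /= in_itv.
apply/rowP => k; have [e1 e2] := E.
by case: k => [[|[|//]] ki]; [rewrite (_ : Ordinal ki = 0) //|
  rewrite (_ : Ordinal ki = 1) //]; exact: val_inj.
Qed.

End Coordinates.

Section PathLength.
Local Open Scope classical_set_scope.
Variables (R : realType) (X : metricType R).
Implicit Types (g : R -> X) (a b c t L h : R) (s : seq R) (x y : X).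

Lemma mdist_pseudometric : pseudometric (fun x y : X => mdist x y).
Proof.
split; [exact: mdistxx | exact: mdist_ge0 | exact: metric_sym |].
by move=> p q r; exact: metric_triangle.
Qed.

Fixpoint chord_length g a s : R :=
  if s is b :: s' then mdist (g a) (g b) + chord_length g b s' else 0.

Lemma chord_length_ge0 g a s : 0 <= chord_length g a s.
Proof. by elim: s a => //= b s IH a; rewrite addr_ge0 ?mdist_ge0. Qed.

Lemma chord_lengthE g a b s :
  \sum_(0 <= i < size s) mdist (g (nth b (a :: s) i)) (g (nth b (a :: s) i.+1)) =
  chord_length g a s.
Proof.
elim: s a => [|c s IH] a /=; first by rewrite big_nil.
by rewrite big_nat_recl //= IH.
Qed.

Lemma chord_length_cat g a s s' :
  chord_length g a (s ++ s') = chord_length g a s + chord_length g (last a s) s'.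
Proof. by elim: s a => [|c s IH] a /=; rewrite ?add0r // IH addrA. Qed.

Lemma chord_le_path_length g a b s : itv_partition a b s ->
  ((chord_length g a s)%:E <= path_length a b g)%E.
Proof.
by move=> sab; apply: ereal_sup_ubound; exists s => //; rewrite chord_lengthE.
Qed.

Lemma mdist_le_path_length g a b : a <= b ->
  ((mdist (g a) (g b))%:E <= path_length a b g)%E.
Proof.
rewrite le_eqVlt => /predU1P[->|ab].
  by rewrite mdistxx; apply: (@chord_le_path_length g b b [::]); split => /=.
have := chord_le_path_length g (itv_partition1 ab).
by rewrite /= addr0.
Qed.

(** Concatenating partitions makes length superadditive; the finite bound [T] turns the partial
    lengths into real numbers. *)
Lemma path_length_split g a c b (T : R) : a <= c -> c <= b ->
  (path_length a b g <= T%:E)%E ->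
  exists A B, [/\ path_length a c g = A%:E, path_length c b g = B%:E & A + B <= T].
Proof.
move=> ac cb abT.
have ub s s' : itv_partition a c s -> itv_partition c b s' ->
    chord_length g a s + chord_length g c s' <= T.
  move=> sac scb; rewrite -lee_fin; apply: le_trans abT.
  apply: le_trans (chord_le_path_length g (itv_partition_cat sac scb)).
  by rewrite chord_length_cat; case: sac => _ /eqP ->.
have ex u v : u <= v -> exists s, itv_partition u v s.
  rewrite le_eqVlt => /predU1P[->|uv]; first by exists [::]; split => /=.
  by exists [:: v]; exact: itv_partition1.
have pl_le u v (S : R) : (forall s, itv_partition u v s -> chord_length g u s <= S) ->
    (path_length u v g <= S%:E)%E.
  move=> H; apply: ub_ereal_sup => _ [s suv <-].
  by rewrite chord_lengthE lee_fin H.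
have ge0 u v : u <= v -> (0 <= path_length u v g)%E.
  by move=> /(mdist_le_path_length g); apply: le_trans; rewrite lee_fin mdist_ge0.
have fin u v (S : R) : u <= v -> (path_length u v g <= S%:E)%E ->
    path_length u v g = (fine (path_length u v g))%:E.
  move=> uv uS; rewrite fineK // ge0_fin_numE ?ge0 //.
  exact: le_lt_trans uS (ltry _).
have [s' s'P] := ex c b cb.
have fA : (path_length a c g <= T%:E)%E.
  apply: pl_le => s sP; apply: le_trans (ub _ _ sP s'P).
  by rewrite lerDl chord_length_ge0.
have AE := fin _ _ _ ac fA; set A := fine _ in AE.
(* For each fixed partition [u] of the second part, the supremum over the first part is taken before
   that over [u]. *)
have fB : (path_length c b g <= (T - A)%:E)%E.
  apply: (pl_le c b) => u uP.
  have : (path_length a c g <= (T - chord_length g c u)%:E)%E.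
    by apply: (pl_le a c) => s sP; rewrite lerBrDr; exact: ub.
  by rewrite AE lee_fin; lra.
have BE := fin _ _ _ cb fB; set B := fine _ in BE.
exists A, B; split=> //; move: fB; rewrite BE lee_fin; lra.
Qed.

Lemma short_segment_le h h' x y L g : h <= h' ->
  short_segment h x y L g -> short_segment h' x y L g.
Proof.
move=> hh [L0 cg g0 gL [le1 le2]]; split=> //; split=> //.
by apply: le_trans le2; apply: leeB => //; rewrite lee_fin.
Qed.

Lemma continuous_mdist x : continuous (fun y => mdist x y : R).
Proof.
move=> y; apply/cvgrPdist_lt => e e0.
have : nbhs y (ball y e) by exact: nbhsx_ballx.
apply: filterS => z; rewrite ballEmdist /= => yz.
apply: le_lt_trans yz; rewrite ler_norml.
have := metric_triangle x y z; have := metric_triangle x z y.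
rewrite (metric_sym z y) => h1 h2; apply/andP; split; lra.
Qed.

Lemma short_segment_mdist_attained h x y L g w v :
  short_segment h x y L g ->
  Num.min (mdist w x) (mdist w y) <= v <= Num.max (mdist w x) (mdist w y) ->
  exists2 t, 0 <= t <= L & mdist w (g t) = v.
Proof.
move=> [L0 cg g0 gL _] hv.
have cf : {within `[0, L], continuous (fun t => mdist w (g t))}.
  move=> t; apply: (@continuous_comp (subspace `[0, L]) X R g (fun y => mdist w y)).
    exact: cg.
  exact: continuous_mdist.
have [|t] := @IVT _ _ _ _ v L0 cf; first by rewrite g0 gL; exact: hv.
by rewrite in_itv /= => t0 tv; exists t.
Qed.

End PathLength.

(** * From rCAT(0) to the rough n-point condition *)

Section RoughNPoint.
Variables (R : realType) (X : metricType R).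
Implicit Types (a b c q : X) (h s t : R) (u v : R * R).

Lemma comparison_point_of_mdist h a b L g t r (pb qb ub : 'rV[R]_2) :
  short_segment h a b L g -> 0 <= t <= L -> 0 <= r <= 1 ->
  eucl_dist pb qb = mdist a b -> coords ub = comb r (coords pb) (coords qb) ->
  r * mdist a b <= mdist a (g t) -> (1 - r) * mdist a b <= mdist (g t) b ->
  comparison_point (X := X) pb qb L g t ub.
Proof.
move=> [L0 _ g0 gL _] /andP[t0 tL] r01 pq uE le1 le2; have /andP[r0 r1] := r01.
move: pq; rewrite eucl_distE => pq.
split; first exact: eucl_segment_comb uE.
- rewrite eucl_distE uE dst_combl // pq.
  apply: le_trans (mdist_le_path_length g t0); by rewrite g0 lee_fin.
- rewrite eucl_distE uE dst_combr // pq.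
  apply: le_trans (mdist_le_path_length g tL); by rewrite gL lee_fin.
Qed.

Definition vertices (T : Type) (a b c : T) (i : 'Z_3) : T := nth c [:: a; b; c] i.

Lemma Z3_ind (P : 'Z_3 -> Prop) : P 0 -> P 1 -> P (1 + 1) -> forall i, P i.
Proof.
move=> P0 P1 P2 [[|[|[|//]]] i].
- by rewrite (_ : Ordinal i = 0) //; exact: val_inj.
- by rewrite (_ : Ordinal i = 1) //; exact: val_inj.
- by rewrite (_ : Ordinal i = 1 + 1) //; exact: val_inj.
Qed.

(* The sides of a triangle are oriented cyclically, so one radius of a triangle
   of the fan leaves the apex [a] and the other one enters it.  Orienting the
   radii according to the parity of their index avoids reversing paths. *)
Definition on_outward h a b s q :=
  mdist a q = s * mdist a b /\
  exists L g t, [/\ short_segment h a b L g, 0 <= t <= L & g t = q].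

Definition on_inward h a b s q :=
  mdist a q = s * mdist a b /\
  exists L g t, [/\ short_segment h b a L g, 0 <= t <= L & g t = q].

(** The sides [a b] and [c a] are the given radii, and the length space supplies [b c]. The
    comparison triangle has the apex [a] at the origin. *)
Lemma rCAT0_radii C0 h a b c s t q q' u v : rCAT0 X C0 -> 0 < h ->
  h <= 1 / Num.max 1 (Num.max (mdist a b) (Num.max (mdist a c) (mdist b c))) ->
  0 <= s <= 1 -> 0 <= t <= 1 ->
  on_outward h a b s q -> on_inward h a c t q' ->
  nm u = mdist a b -> nm v = mdist a c -> dst u v = mdist b c ->
  mdist q q' <= dst (s * u.1, s * u.2) (t * v.1, t * v.2) + C0.
Proof.
move=> [C00 _ lX cat] h0 hH s01 t01 [dq [L [g [r [sg r0 gr]]]]]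
  [dq' [L' [g' [r' [sg' r0' gr']]]]] ua va uv.
have /andP[s0 s1] := s01; have /andP[t0 t1] := t01.
have [L2 [g2 sg2]] := lX b c h h0.
pose x := vertices a b c; pose xb := vertices (of_coords (0, 0)) (of_coords u) (of_coords v).
pose LL := vertices L L2 L'; pose gg := vertices g g2 g'.
set H := 1 / _ in hH.
have st : short_triangle H x LL gg.
  by elim/Z3_ind; apply: short_segment_le hH _; [exact: sg | exact: sg2 | exact: sg'].
have ct : comparison_triangle x xb.
  elim/Z3_ind; elim/Z3_ind; rewrite eucl_distE /x /xb /vertices /= !of_coordsK;
    rewrite ?dstxx ?mdistxx // ?dst0 //.
  - by rewrite dstC dst0.
  - by rewrite dstC dst0.
  - by rewrite ua metric_sym.
  - by rewrite va metric_sym.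
  - by rewrite dstC uv metric_sym.
have := cat x LL gg xb st ct 0 (1 + 1) r r'
  (of_coords (s * u.1, s * u.2)) (of_coords (t * v.1, t * v.2)) isT r0 r0'.
rewrite eucl_distE !of_coordsK -[gg 0]/g -[gg (1 + 1)]/g' gr gr'; apply.
- apply: comparison_point_of_mdist sg r0 s01 _ _ _ _.
  + exact: (ct 0 1).
  + by rewrite /xb /vertices /= !of_coordsK /comb /=; congr pair; ring.
  + by rewrite gr dq.
  + by rewrite gr; have := metric_triangle a q b; rewrite dq; lra.
(* This side runs from [c] to [a], hence the ratio [1 - t]. *)
- have t01' : 0 <= 1 - t <= 1 by apply/andP; split; lra.
  apply: comparison_point_of_mdist sg' r0' t01' _ _ _ _.
  + exact: (ct (1 + 1) 0).
  + by rewrite /xb /vertices /= !of_coordsK /comb /=; congr pair; ring.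
  + rewrite gr' !(metric_sym c); have := metric_triangle a q' c; rewrite dq'; lra.
  + by rewrite gr' (metric_sym q') dq' subKr (metric_sym c).
Qed.

Lemma radius_exists h a b s : length_space X -> 0 < h -> 0 <= s <= 1 ->
  (exists q, on_outward h a b s q /\ (s = 1 -> q = b)) /\
  (exists q, on_inward h a b s q /\ (s = 1 -> q = b)).
Proof.
move=> lX h0 s01; have /andP[s0 s1] := s01.
have d0 := mdist_ge0 a b.
have mm : Num.min 0 (mdist a b) <= s * mdist a b <= Num.max 0 (mdist a b).
  by rewrite min_l // max_r // mulr_ge0 //= ler_piMl.
have [L [g sg]] := lX a b h h0.
have [L' [g' sg']] := lX b a h h0.
have [L0 _ g0 gL _] := sg; have [L0' _ g0' gL' _] := sg'.
(* Intermediate values only give a point at the right distance from [a]; for [s = 1] the end [b]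
   itself is required. *)
case: (eqVneq s 1) => [->|sn1].
  split; exists b; split=> //; split; rewrite ?mul1r //.
    by exists L, g, L; rewrite L0 lexx.
  by exists L', g', 0; rewrite L0' lexx.
split.
  have [|t tL tE] := short_segment_mdist_attained sg (w := a) (v := s * mdist a b).
    by rewrite mdistxx.
  exists (g t); split; last by move=> s1E; rewrite s1E eqxx in sn1.
  by split=> //; exists L, g, t.
have [|t tL tE] := short_segment_mdist_attained sg' (w := a) (v := s * mdist a b).
  by rewrite mdistxx minC maxC.
exists (g' t); split; last by move=> s1E; rewrite s1E eqxx in sn1.
by split=> //; exists L', g', t.
Qed.

Theorem rCAT0_rough_n_point C0 n : 0 < C0 -> rCAT0 X C0 -> (3 <= n)%N ->
  rough_n_point X ((n%:R - 2) * C0) n.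
Proof.
move=> C00 cat n3; have [_ _ lX _] := cat.
have nC : (n%:R - 2 : R) = (n.-2)%:R by rewrite -natrB //; [congr (_%:R); lia | lia].
rewrite nC; split=> //; first by rewrite mulr_ge0 // ltW.
case: n n3 nC => [|[|n]] // n1 _ x.
pose y k := x (inord k).
(* A common bound for all distances, so that one [h] is admissible for every triangle of the fan. *)
pose M : R := 1 + \sum_(i < n.+2) \sum_(j < n.+2) mdist (y i) (y j).
have sum0 i : 0 <= \sum_(j < n.+2) mdist (y i) (y j).
  by apply: sumr_ge0 => j _; exact: mdist_ge0.
have M1 : 1 <= M by rewrite lerDl; apply: sumr_ge0.
have yM i j : (i <= n.+1)%N -> (j <= n.+1)%N -> mdist (y i) (y j) <= M.
  move=> iN jN; rewrite /M (bigD1 (Ordinal (iN : (i < n.+2)%N))) //=.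
  rewrite (bigD1 (Ordinal (jN : (j < n.+2)%N))) //=.
  have e1 : 0 <= \sum_(k < n.+2 | k != Ordinal (jN : (j < n.+2)%N)) mdist (y i) (y k).
    by apply: sumr_ge0 => k _; exact: mdist_ge0.
  have e2 : 0 <= \sum_(k < n.+2 | k != Ordinal (iN : (i < n.+2)%N))
      \sum_(j < n.+2) mdist (y k) (y j) by exact: sumr_ge0.
  lra.
have M0 : 0 < M by lra.
pose h := 1 / M.
have h0 : 0 < h by rewrite divr_gt0.
have hH i j k : (i <= n.+1)%N -> (j <= n.+1)%N -> (k <= n.+1)%N ->
    h <= 1 / Num.max 1 (Num.max (mdist (y i) (y j)) (Num.max (mdist (y i) (y k)) (mdist (y j) (y k)))).
  move=> iN jN kN; rewrite /h !mul1r lef_pV2 ?posrE //; last by rewrite lt_max ltr01.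
  by rewrite !ge_max M1 !yM.
(* One point is fixed per index and ratio, so that the two triangles sharing a radius use the same
   point. *)
pose Q (ks : nat * R) q := 0 <= ks.2 <= 1 ->
  (if odd ks.1 then on_inward else on_outward) h (y 0%N) (y ks.1) ks.2 q /\
  (ks.2 = 1 -> q = y ks.1).
have [z zP] : {z & forall ks, Q ks (z ks)}.
  apply: boolp.choice => -[k s].
  case: (boolP (0 <= s <= 1)) => [s01|ns]; last by exists (y 0%N); rewrite /Q /= (negbTE ns).
  have [[q qP] [q' qP']] := radius_exists (y 0%N) (y k) lX h0 s01.
  by rewrite /Q /=; case: (odd k); [exists q' | exists q].
have zin k s : 0 <= s <= 1 -> odd k -> on_inward h (y 0%N) (y k) s (z (k, s)).
  by move=> s01 ok; have [] := zP (k, s) s01; rewrite /= ok.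
have zout k s : 0 <= s <= 1 -> ~~ odd k -> on_outward h (y 0%N) (y k) s (z (k, s)).
  by move=> s01 ok; have [] := zP (k, s) s01; rewrite /= (negbTE ok).
have zb k s : (0 < k <= n.+1)%N -> 0 <= s <= 1 ->
    mdist (y 0%N) (z (k, s)) <= s * mdist (y 0%N) (y k).
  move=> _ s01; case: (boolP (odd k)) => ok.
    by have [-> _] := zin k s s01 ok.
  by have [-> _] := zout k s s01 ok.
have z1 k : z (k, 1) = y k.
  by have [|_] := zP (k, 1); rewrite /= ?ler01 ?lexx // => ->.
have zc k s t u v : (0 < k < n.+1)%N -> 0 <= s <= 1 -> 0 <= t <= 1 ->
    nm u = mdist (y 0%N) (y k) -> nm v = mdist (y 0%N) (y k.+1) ->
    dst u v = mdist (y k) (y k.+1) ->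
    mdist (z (k, s)) (z (k.+1, t)) <= dst (s * u.1, s * u.2) (t * v.1, t * v.2) + C0.
  (* For odd [k] the outward radius is the one of index [k.+1], so the triangle is read in the
     opposite order. *)
  move=> /andP[k0 kN] s01 t01 ua va uv; case: (boolP (odd k)) => ok.
    rewrite metric_sym dstC; apply: (rCAT0_radii cat h0 (hH 0%N k.+1 k _ _ _)) => //.
    - exact: ltnW.
    - by apply: zout; rewrite //= ok.
    - exact: zin.
    - by rewrite dstC uv metric_sym.
  apply: (rCAT0_radii cat h0 (hH 0%N k k.+1 _ _ _)) => //.
  - exact: ltnW.
  - exact: zout.
  - by apply: zin; rewrite //= ok.
have [xb [fx ex cx dx _]] := rough_fan_majorized (mdist_pseudometric X) (ltW C00)
  (z := fun k s => z (k, s)) zb z1 zc (ltnSn n).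
have yx (i : 'I_n.+2) : x i = y i by rewrite /y inord_val.
exists (fun i => of_coords (xb i)); split.
- move=> i; rewrite eucl_distE !of_coordsK !yx /=.
  have := ltn_ord i; rewrite leq_eqVlt => /predU1P[E|iN].
    by rewrite E modnn; case: E => ->; rewrite cx.
  by rewrite modn_small // metric_sym dstC; have [] := ex i iN.
- move=> i j i0 j0; rewrite eucl_distE !of_coordsK !yx i0.
  by have := ltn_ord j; case: (nat_of_ord j) j0 => // k _ kn; have [] := ex k kn.
move=> i j _ _; rewrite eucl_distE !of_coordsK !yx; by apply: dx; rewrite -ltnS ltn_ord.
Qed.

End RoughNPoint.

(** * From the rough n-point condition to rCAT(0) *)

Section FivePointCAT0.
Variables (R : realType) (X : metricType R).
Implicit Types (a b c q : X) (h s t : R).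

(* All that the estimate retains of a point [q] of an [h]-short segment from [a]
   to [b] with comparison point at ratio [s]: [A] and [B] are the lengths of the
   two subpaths. *)
Definition near_segment h a b s q := exists A B, [/\ mdist a q <= A,
  mdist q b <= B, s * mdist a b <= A, (1 - s) * mdist a b <= B &
  A + B <= mdist a b + h].

Lemma near_segmentC h a b s q : near_segment h a b s q -> near_segment h b a (1 - s) q.
Proof.
move=> [A [B [h1 h2 h3 h4 h5]]]; exists B, A.
by split; rewrite ?(metric_sym b a) ?subKr //; first [by rewrite metric_sym | lra].
Qed.

Lemma near_segment_of_comparison h a b L g t (pb qb ub : 'rV[R]_2) :
  short_segment h a b L g -> 0 <= t <= L -> eucl_dist pb qb = mdist a b ->
  comparison_point (X := X) pb qb L g t ub ->
  exists2 s, 0 <= s <= 1 /\ coords ub = comb s (coords pb) (coords qb) &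
    near_segment h a b s (g t).
Proof.
move=> [L0 _ g0 gL [_ le2]] /andP[t0 tL]; rewrite eucl_distE => pq [].
move=> /eucl_segmentP[s s01 uE]; have /andP[s0 s1] := s01.
rewrite !eucl_distE uE dst_combl // dst_combr // pq => c1 c2.
have le2' : (path_length 0 L g <= (mdist a b + h)%:E)%E.
  by rewrite EFinD -leeBlDr.
have [A [B [AE BE AB]]] := path_length_split t0 tL le2'.
exists s => //; exists A, B; split=> //.
- by rewrite -lee_fin -AE -g0; exact: mdist_le_path_length.
- by rewrite -lee_fin -BE -gL; exact: mdist_le_path_length.
- by rewrite -lee_fin -AE.
- by rewrite -lee_fin -BE.
Qed.

(** In the cyclic order [a], [q], [b], [c], [q'] the parts of both sides and the third side are
    edges, whose lengths are kept; [a] comes first, so its distances do not shrink. *)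
Lemma rough_five_point C n a q b c q' : (5 <= n)%N -> rough_n_point X C n ->
  exists a' u b' c' v : R * R,
  [/\ [/\ dst a' u = mdist a q, dst u b' = mdist q b, dst b' c' = mdist b c,
      dst c' v = mdist c q' & dst v a' = mdist q' a],
   mdist a b <= dst a' b', mdist a c <= dst a' c' &
   mdist q q' <= dst u v + C].
Proof.
move=> n5 [C0 _ npt].
(* The default [q'] fills every position from 4 on, which yields [n] points. *)
pose x k := nth q' [:: a; q; b; c] k.
have [xb [e1 e2 e3]] := npt (fun i => x i).
case: n n5 npt xb e1 e2 e3 => // n n5 npt xb e1 e2 e3.
pose y k := coords (xb (inord k)).
have vE k : (k <= n)%N -> (inord k : 'I_n.+1) = k :> nat by move=> kn; rewrite inordK.
have es k : (k < n)%N -> dst (y k) (y k.+1) = mdist (x k) (x k.+1).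
  move=> kn; have := e1 (inord k); rewrite eucl_distE /= vE ?(ltnW kn) //.
  rewrite modn_small // (_ : ordS (inord k) = inord k.+1); last first.
    by apply: val_inj; rewrite /= !vE ?(ltnW kn) // modn_small.
  by rewrite dstC metric_sym => ->.
(* The copies of [q'] are consecutive, so edges of length zero join their images. *)
have y4 k : (4 <= k <= n)%N -> y k = y 4%N.
  elim: k => // k IH /andP[]; rewrite leq_eqVlt => /predU1P[->//|k4 kn].
  rewrite -IH; last by rewrite -ltnS k4 ltnW.
  by apply/esym/dst_eq0; rewrite es // /x !nth_default ?mdistxx //= ltnW.
have ec : dst (y 4%N) (y 0%N) = mdist q' a.
  rewrite -(y4 n) ?leqnn ?andbT //.
  have := e1 (inord n); rewrite eucl_distE /= vE // modnn.
  rewrite (_ : ordS (inord n) = inord 0); last first.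
    by apply: val_inj; rewrite /= !vE // modnn.
  have -> : x n = q' by rewrite /x nth_default.
  by rewrite /y dstC metric_sym => <-.
have lt5 k : (k < 5)%N -> (k <= n)%N by move=> k5; rewrite -ltnS; exact: leq_trans k5 n5.
exists (y 0%N), (y 1%N), (y 2%N), (y 3%N), (y 4%N); split.
- by rewrite !es ?lt5.
- have := e2 (inord 0%N) (inord 2%N); rewrite eucl_distE !vE ?lt5 //; exact.
- have := e2 (inord 0%N) (inord 3%N); rewrite eucl_distE !vE ?lt5 //; exact.
- have := e3 (inord 1%N) (inord 4%N); rewrite eucl_distE !vE ?lt5 //; exact.
Qed.

Lemma near_segments_estimate C n h a b c q q' s t (a' b' c' : R * R) :
  (5 <= n)%N -> rough_n_point X C n -> 0 <= h <= 1 ->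
  h * mdist a b <= 1 -> h * mdist a c <= 1 ->
  dst a' b' = mdist a b -> dst a' c' = mdist a c -> dst b' c' = mdist b c ->
  0 <= s <= 1 -> 0 <= t <= 1 ->
  near_segment h a b s q -> near_segment h a c t q' ->
  mdist q q' <= dst (comb s a' b') (comb t a' c') + (C + 2 * Num.sqrt 3).
Proof.
move=> n5 npt h01 hb hc ab ac bc s01 t01 [Au [Bu [u1 u2 u3 u4 u5]]]
  [Av [Bv [v1 v2 v3 v4 v5]]].
have [a'' [u [b'' [c'' [v [[d1 d2 d3 d4 d5] d6 d7 d8]]]]]] :=
  rough_five_point a q b c q' n5 npt.
have : dst u v <= dst (comb s a' b') (comb t a' c') + 2 * Num.sqrt 3.
  apply: (@five_point_estimate _ _ _ _ a'' b'' c'' _ _ _ _ h Au Bu Av Bv);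
    rewrite ?ab ?ac ?bc ?d1 ?d2 ?d3 //.
  - by rewrite dstC d5 metric_sym.
  - by rewrite dstC d4 metric_sym.
lra.
Qed.

Lemma Z3_neqP (i j : 'Z_3) : i != j -> j = i + 1 \/ i = j + 1.
Proof.
by elim/Z3_ind: i; elim/Z3_ind: j => //= _; (left + right); exact: val_inj.
Qed.

Theorem rough_n_point_rCAT0 C n : length_space X -> (5 <= n)%N -> 0 <= C ->
  rough_n_point X C n -> rCAT0 X (C + 2 * Num.sqrt 3).
Proof.
move=> lX n5 C0 npt; split=> //.
- by rewrite ltr_wpDl // mulr_gt0 // sqrtr_gt0.
- by move=> x y z; rewrite divr_gt0 // lt_max ltr01.
move=> x L g xb st ct i j t s ub vb ij ti sj cu cv.
set M := Num.max 1 _ in st; set h := 1 / M in st.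
have M1 : 1 <= M by rewrite le_max lexx.
have M0 : 0 < M by lra.
have h01 : 0 <= h <= 1 by rewrite divr_ge0 ?(ltW M0) //= ler_pdivrMr // mul1r.
have [x01 x02 x12] : [/\ mdist (x 0) (x 1) <= M, mdist (x 0) (x (1 + 1)) <= M &
    mdist (x 1) (x (1 + 1)) <= M] by rewrite /M !le_max !lexx !orbT.
have hM k l : h * mdist (x k) (x l) <= 1.
  rewrite /h mulrC mulrA mulr1 ler_pdivrMr // mul1r.
  by elim/Z3_ind: k; elim/Z3_ind: l; rewrite ?mdistxx ?(ltW M0) // metric_sym.
have [r [r01 uE] nu] := near_segment_of_comparison (st i) ti (ct _ _) cu.
have [r' [r01' vE] nv] := near_segment_of_comparison (st j) sj (ct _ _) cv.
have r1 : 0 <= 1 - r <= 1 by apply/andP; split; lra.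
have r1' : 0 <= 1 - r' <= 1 by apply/andP; split; lra.
have dE k l : dst (coords (xb k)) (coords (xb l)) = mdist (x k) (x l).
  by rewrite -eucl_distE ct.
have combC (w : R) (p p' : R * R) : comb w p p' = comb (1 - w) p' p.
  by rewrite /comb; congr pair; ring.
rewrite eucl_distE uE vE.
(* Distinct sides share a vertex, the end of one and the start of the other; the former is reversed
   so that both start there. *)
case: (Z3_neqP ij) => E.
  rewrite E in nv *; rewrite combC.
  exact: near_segments_estimate n5 npt h01 _ _ _ _ _ r1 r01' (near_segmentC nu) nv.
rewrite E in nu *; rewrite [comb r' _ _]combC.
exact: near_segments_estimate n5 npt h01 _ _ _ _ _ r01 r1' nu (near_segmentC nv).
Qed.

End FivePointCAT0.

Theorem theorem1p1 (R : realType) (X : metricType R) (hX : length_space X) :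
  (forall (n : nat) (C : R), (5 <= n)%N -> 0 <= C ->
     rough_n_point X C n -> rCAT0 X (C + 2 * Num.sqrt 3)) /\
  (forall C0 : R, 0 < C0 -> rCAT0 X C0 ->
     forall n : nat, (3 <= n)%N -> rough_n_point X ((n%:R - 2) * C0) n).
Proof.
split=> [n C n5 C0|C0 C00 cat n n3]; first exact: rough_n_point_rCAT0.
exact: rCAT0_rough_n_point.
Qed.
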